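(* Let $d\ge1$ and $0<\mu\le\frac12$. Then the conclusions of the Ferromagnetism theorem hold with $L_\#(\mu)=L_*(\mu)$ and $U_\#(\mu)=U_*(\mu,\alpha_*(\mu))$; that is, for all even $L\ge L_*(\mu)$ and all $U\ge U_*(\mu,\alpha_*(\mu))$ one has $E^{(\mathrm{hfz})}_{\mu,U}=\mathrm{Tr}\{[-\Delta-\mu]_-\}$, and if moreover $\mu$ is not an eigenvalue of $-\Delta$, every minimizer $(\gamma_\uparrow,\gamma_\downarrow)$ of the HFz functional is either $(\mathbb{1}[-\Delta<\mu],0)$ or $(0,\mathbb{1}[-\Delta<\mu])$. Here $$L_*(\mu)=2M_*(\mu)=24(4d)^2\mu^{-2},\qquad \kappa(\mu)=\frac{\mu^d}{4^{2d+1}e^d d^d}\Big[1+2\ln 2\,(d^{-1}+1)+\ln(4d\mu^{-1})\Big]^{-2d},$$ $$\alpha_*(\mu)=\frac{|S^{d-1}|\,\mu^{(2+d)/2}}{2^{1+d/2}(2\pi)^d(4d)^5},\qquad \delta_*(\mu,\alpha)=\min\Big\{\frac{\alpha^2}{(12d)^2},\ \frac{\alpha}{3\mu[4M_*(\mu)+1]^d},\ \frac{\kappa(\mu)}{2}\Big\},$$ $$U_*(\mu,\alpha)=\max\Big\{\frac{2\mu}{\delta_*(\mu,\alpha)},\ \frac{24d^2}{\alpha\,\delta_*(\mu,\alpha)}\Big\},$$ and $|S^{d-1}|=2\pi^{d/2}/\Gamma(d/2)$.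
   Context: $\Lambda=\mathbb{Z}_L^d$ periodic lattice, $L$ even; $T_{x,y}=1$ if $|x-y|_1=1$, else $0$; $\Delta_{x,y}=T_{x,y}-2d\delta_{x,y}$; $K_\mu=-\Delta-\mu$; $[X]_-=\min\{X,0\}$ so $\mathrm{Tr}[X]_-$ is the sum of negative eigenvalues of $X$. The HFz functional is $\mathcal{E}^{(\mathrm{hfz})}_{\mu,U}(\gamma_\uparrow,\gamma_\downarrow)=\mathrm{Tr}\{K_\mu(\gamma_\uparrow+\gamma_\downarrow)\}+U\sum_{x}\rho_\uparrow(x)\rho_\downarrow(x)$ with $\rho_\sigma(x)=(\gamma_\sigma)_{x,x}$, and $E^{(\mathrm{hfz})}_{\mu,U}$ is its minimum over Hermitian $\Lambda\times\Lambda$ matrices $0\le\gamma_\uparrow,\gamma_\downarrow\le1$. *)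

(* Defs.v *)
From mathcomp Require Import all_boot all_order all_algebra.
From mathcomp Require Import all_classical all_reals all_analysis.
From mathcomp Require Import complex.
Unset Printing Implicit Defensive.
Import Order.TTheory GRing.Theory Num.Theory.
Local Open Scope ring_scope.

Section HFz.
Context {R : realType}.
Local Notation C := R[i].

Definition site (d L : nat) := {ffun 'I_d -> 'I_L}.

Definition nbZ {L : nat} (a b : 'I_L) : bool :=
  (a != b) && (((b : nat) == (a.+1 %% L)%N) || ((a : nat) == (b.+1 %% L)%N)).

(* |x - y|_1 = 1 for the periodic l^1 distance on Z_L^d *)
Definition adj {d L : nat} (x y : site d L) : bool :=
  [exists i : 'I_d, nbZ (x i) (y i) && [forall j : 'I_d, (j != i) ==> (x j == y j)]].

(* matrices indexed by Lambda, via the enumeration 'I_#|Lambda| ~ Lambda *)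
Definition nsites (d L : nat) := #|{: site d L}|.

Definition hopT (d L : nat) : 'M[C]_(nsites d L) :=
  \matrix_(i, j) (adj (enum_val i) (enum_val j))%:R.

Definition lap (d L : nat) : 'M[C]_(nsites d L) := hopT d L - (2 * d)%:R%:M.

Definition Kmu (d L : nat) (mu : R) : 'M[C]_(nsites d L) :=
  - lap d L - (mu%:C)%C%:M.

Definition ctr {m n} (A : 'M[C]_(m, n)) : 'M[C]_(n, m) := (map_mx conjc A)^T.
Definition hermitian {n} (A : 'M[C]_n) : Prop := ctr A = A.
Definition psd {n} (A : 'M[C]_n) : Prop :=
  hermitian A /\ forall v : 'cV[C]_n, 0 <= (ctr v *m A *m v) 0 0.

Definition admissible {n} (g : 'M[C]_n) : Prop := psd g /\ psd (1%:M - g).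

Definition Ehfz (d L : nat) (mu U : R) (gu gd : 'M[C]_(nsites d L)) : C :=
  \tr (Kmu d L mu *m (gu + gd)) + (U%:C)%C * \sum_i (gu i i * gd i i).

Definition is_hfz_min_value (d L : nat) (mu U : R) (v : C) : Prop :=
  (exists gu gd, [/\ admissible gu, admissible gd & Ehfz d L mu U gu gd = v])
  /\ forall gu gd, admissible gu -> admissible gd -> v <= Ehfz d L mu U gu gd.

Definition is_hfz_minimizer (d L : nat) (mu U : R) (gu gd : 'M[C]_(nsites d L)) : Prop :=
  [/\ admissible gu, admissible gd &
      forall hu hd, admissible hu -> admissible hd ->
        Ehfz d L mu U gu gd <= Ehfz d L mu U hu hd].

(* Tr[X]_- : sum of the negative eigenvalues of X, counted with multiplicity,
   i.e. of the negative roots of its characteristic polynomial *)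
Definition eigen_seq {n} (X : 'M[C]_n) : seq C :=
  projT1 (closed_field_poly_normal (char_poly X)).
Definition trneg {n} (X : 'M[C]_n) : C := \sum_(a <- eigen_seq X | a < 0) a.

Definition spec_proj_below {n} (A : 'M[C]_n) (mu : R) (P : 'M[C]_n) : Prop :=
  forall (a : C) (v : 'cV[C]_n), A *m v = a *: v ->
    P *m v = (if a < (mu%:C)%C then v else 0).

Definition Gamma (x : R) : R :=
  Rintegral lebesgue_measure `]0%R, +oo[%classic
    (fun t : R => t `^ (x - 1) * expR (- t)).

Definition sphere_area (d : nat) : R :=
  2 * pi `^ (d%:R / 2) / Gamma (d%:R / 2).

Definition Mstar (d : nat) (mu : R) : R := 12 * (4 * d%:R) ^+ 2 / mu ^+ 2.
Definition Lstar (d : nat) (mu : R) : R := 2 * Mstar d mu.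

Definition kappa (d : nat) (mu : R) : R :=
  mu ^+ d / (4 ^+ (2 * d + 1) * expR 1 ^+ d * d%:R ^+ d)
  * (1 + 2 * ln 2 * (d%:R^-1 + 1) + ln (4 * d%:R / mu)) ^- (2 * d).

Definition alphastar (d : nat) (mu : R) : R :=
  sphere_area d * mu `^ ((2 + d%:R) / 2)
  / (2 `^ (1 + d%:R / 2) * (2 * pi) ^+ d * (4 * d%:R) ^+ 5).

Definition deltastar (d : nat) (mu alpha : R) : R :=
  Num.min (alpha ^+ 2 / (12 * d%:R) ^+ 2)
    (Num.min (alpha / (3 * mu * (4 * Mstar d mu + 1) ^+ d)) (kappa d mu / 2)).

Definition Ustar (d : nat) (mu alpha : R) : R :=
  Num.max (2 * mu / deltastar d mu alpha)
          (24 * d%:R ^+ 2 / (alpha * deltastar d mu alpha)).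

End HFz.

(* Main.v *)
Require Import Defs.
From mathcomp Require Import all_boot all_order all_algebra.
From mathcomp Require Import all_classical all_reals all_analysis.
From mathcomp Require Import complex measurable_realfun.
From mathcomp Require Import ring lra zify.
Import Order.TTheory GRing.Theory Num.Theory.
Set Implicit Arguments.
Unset Strict Implicit.
Local Open Scope complex_scope.
Local Open Scope ring_scope.

(** Label a site by the spin whose density is at least [theta ^ 2] and dominates,
    and make every site where both densities are smaller a block of its own.
    Deleting from the Laplacian all edges between different blocks gives a block
    Hamiltonian [A].  On a cut edge, and on the minority spin of a labelled site,
    Cauchy-Schwarz for the density matrices together with the repulsion [U] shows that
    replacing the Hubbard energy by [Tr A g], for the block-compressed density
    matrix [g], costs at most [4 theta] per cut edge.

    Conversely, cutting raises the ground state energy by at least [c] per cut edge: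
    for a plane wave [e] with energy [k <= - mu / 2], the vector [b = (A - k) e] lives on
    the ends of cut edges, where [<b, (A + mu) b> >= |b| ^ 2] because each such site has
    lost a neighbour; since [mu <= 1 / 2], a definite part of [e] must lie in the positive
    spectral subspace of [A], so the Fermi sea of [A] misses low plane waves of
    [- Delta].  With [4 theta < c] the two bounds give
    [E >= Tr [K]_- + (c - 4 theta) * #(cut edges) + (positive) * (minority density)],
    and equality forces a single block with no minority spin.

    Low plane waves are counted in a cube of momenta; the resulting loss against the ball
    used for [alphastar] is absorbed by the size of [Ustar]. *)

Local Notation re := complex.Re.
Local Notation im := complex.Im.

(** * Positive semidefinite matrices *)
Section Complex.
Context {R : realType}.
Local Notation C := R[i].

(** The squared modulus, valued in [R] so that estimates can be made in a real field rather than in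
    the partial order of [C]. *)
Definition sqn (z : C) : R := re z ^+ 2 + im z ^+ 2.

Lemma re_sum I (r : seq I) (P : pred I) (F : I -> C) :
  re (\sum_(i <- r | P i) F i) = \sum_(i <- r | P i) re (F i).
Proof. by apply: (big_morph (@complex.Re R)) => // -[a b] [c e]. Qed.

Lemma reD (a b : C) : re (a + b) = re a + re b. Proof. by case: a b => [? ?] []. Qed.
Lemma reN (a : C) : re (- a) = - re a. Proof. by case: a. Qed.
Lemma reCM (a : R) (b : C) : re (a%:C * b) = a * re b.
Proof. by case: b => b c /=; rewrite mul0r subr0. Qed.
Lemma re_conj (z : C) : re (conjc z) = re z. Proof. by case: z. Qed.

Lemma sqn_ge0 z : 0 <= sqn z. Proof. by rewrite addr_ge0 // sqr_ge0. Qed.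
Lemma sqn_conj z : sqn (conjc z) = sqn z.
Proof. by case: z => a b; rewrite /sqn /= sqrrN. Qed.
Lemma sqnM a b : sqn (a * b) = sqn a * sqn b.
Proof. by case: a b => [a b] [c e]; rewrite /sqn /=; ring. Qed.
Lemma sqnC (a : R) : sqn a%:C = a ^+ 2.
Proof. by rewrite /sqn /= expr0n addr0. Qed.
Lemma mul_conjc_sqn z : conjc z * z = (sqn z)%:C.
Proof.
case: z => a b; rewrite /sqn /=; apply/eqP; rewrite eq_complex /=.
by apply/andP; split; apply/eqP; ring.
Qed.
Lemma sqn_eq0 z : (sqn z == 0) = (z == 0).
Proof.
case: z => a b; rewrite /sqn /= paddr_eq0 ?sqr_ge0 // !sqrf_eq0.
by rewrite eq_complex.
Qed.

Lemma CC_inj : injective (fun x : R => x%:C).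
Proof. by move=> a b []. Qed.

Lemma conjc_fixed (z : C) : conjc z = z -> z = (re z)%:C.
Proof.
case: z => a b [h]; congr (_ +i* _)%C; apply/eqP.
by move/eqP: h; rewrite eq_sym -addr_eq0 -mulr2n mulrn_eq0 /=.
Qed.

End Complex.

Section Matrices.
Context {R : realType}.
Local Notation C := R[i].

Lemma ctrE m n (A : 'M[C]_(m, n)) i j : ctr A i j = conjc (A j i).
Proof. by rewrite !mxE. Qed.
Lemma ctrM m n p (A : 'M[C]_(m, n)) (B : 'M[C]_(n, p)) :
  ctr (A *m B) = ctr B *m ctr A.
Proof. by rewrite /ctr map_mxM trmx_mul. Qed.
Lemma ctrK m n (A : 'M[C]_(m, n)) : ctr (ctr A) = A.
Proof. by apply/matrixP => i j; rewrite !ctrE conjcK. Qed.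
Lemma ctrD m n (A B : 'M[C]_(m, n)) : ctr (A + B) = ctr A + ctr B.
Proof. by apply/matrixP => i j; rewrite !(mxE, ctrE) rmorphD. Qed.
Lemma ctrN m n (A : 'M[C]_(m, n)) : ctr (- A) = - ctr A.
Proof. by apply/matrixP => i j; rewrite !(mxE, ctrE) rmorphN. Qed.
Lemma ctr1 n : ctr (1%:M : 'M[C]_n) = 1%:M.
Proof. by rewrite /ctr map_mx1 trmx1. Qed.

Definition rdiag n (t : 'I_n -> R) : 'M[C]_n := diag_mx (\row_i (t i)%:C).

Lemma rdiagE n (t : 'I_n -> R) i j : rdiag t i j = (t i)%:C *+ (i == j).
Proof. by rewrite !mxE. Qed.

Lemma ctr_rdiag n (t : 'I_n -> R) : ctr (rdiag t) = rdiag t.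
Proof.
apply/matrixP => i j; rewrite ctrE !rdiagE eq_sym.
by case: eqP => [->|_]; rewrite ?mulr0n ?rmorph0 // !mulr1n conjc_real.
Qed.

Lemma rdiag_mul n m (t : 'I_n -> R) (A : 'M[C]_(n, m)) i j :
  (rdiag t *m A) i j = (t i)%:C * A i j.
Proof. by rewrite /rdiag mul_diag_mx !mxE. Qed.

Lemma mul_rdiag n m (t : 'I_n -> R) (A : 'M[C]_(m, n)) i j :
  (A *m rdiag t) i j = A i j * (t j)%:C.
Proof. by rewrite /rdiag mul_mx_diag !mxE. Qed.

Lemma ctr_mul_self n m (v : 'M[C]_(n, m)) j :
  (ctr v *m v) j j = (\sum_i sqn (v i j))%:C.
Proof.
rewrite mxE rmorph_sum /=; apply: eq_bigr => i _.
by rewrite ctrE mul_conjc_sqn.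
Qed.

Lemma psd_conj n m (V : 'M[C]_(m, n)) (g : 'M[C]_n) :
  psd g -> psd (V *m g *m ctr V).
Proof.
case=> hg pg; split; first by rewrite /Defs.hermitian !ctrM ctrK hg mulmxA.
by move=> v; have := pg (ctr V *m v); rewrite ctrM ctrK !mulmxA.
Qed.

Lemma admissible_conj n (V g : 'M[C]_n) : V *m ctr V = 1%:M ->
  admissible g -> admissible (V *m g *m ctr V).
Proof.
move=> hV [h1 h2]; split; first exact: psd_conj.
have := psd_conj V h2.
by rewrite mulmxBr mulmx1 mulmxBl hV.
Qed.

Section Psd.
Context {n : nat} (g : 'M[C]_n) (hg : psd g).

Lemma psd_diag i : g i i = (re (g i i))%:C.
Proof.
case: hg => h _; apply: conjc_fixed.
by rewrite -ctrE h.
Qed.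

Lemma psd_conj_entry i j : g i j = conjc (g j i).
Proof. by case: hg => h _; rewrite -ctrE h. Qed.

Lemma form_add (u v : 'cV[C]_n) : (ctr (u + v) *m g *m (u + v)) 0 0 =
  (ctr u *m g *m u) 0 0 + (ctr v *m g *m u) 0 0
  + ((ctr u *m g *m v) 0 0 + (ctr v *m g *m v) 0 0).
Proof.
have addE (M N : 'M[C]_1) : (M + N) 0 0 = M 0 0 + N 0 0 by rewrite mxE.
by rewrite -!addE -!mulmxDl -mulmxDr -ctrD.
Qed.

Lemma form_entry i j (a b : C) :
  (ctr (a *: delta_mx i 0 : 'cV[C]_n) *m g *m (b *: delta_mx j 0 : 'cV[C]_n)) 0 0
    = conjc a * g i j * b.
Proof.
have -> : ctr (a *: delta_mx i 0 : 'cV[C]_n) = conjc a *: delta_mx 0 i.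
  apply/matrixP => x y; rewrite ctrE !mxE rmorphM /= andbC.
  by congr (_ * _); case: (_ && _); rewrite ?rmorph1 ?rmorph0.
rewrite -!scalemxAl -scalemxAr -rowE -colE !mxE; ring.
Qed.

(** Positivity tested on the vector [a e_i + b e_j]; the entry bounds below are instances. The case
    [i = j] is included. *)
Lemma psd_form2 i j (a b : C) : 0 <=
  sqn a * re (g i i) + sqn b * re (g j j) + 2 * re (conjc a * g i j * b).
Proof.
case: (hg) => h /(_ (a *: delta_mx i 0 + b *: delta_mx j 0)).
have -> : forall w : 'cV[C]_n, w = a *: delta_mx i 0 + b *: delta_mx j 0 ->
    (ctr w *m g *m w) 0 0 = conjc a * g i i * a + conjc b * g j i * a
      + (conjc a * g i j * b + conjc b * g j j * b) => //.
  move=> w ->; rewrite form_add.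
  by congr (_ + _ + (_ + _)); exact: form_entry.
rewrite lecE => /andP[_] /=; rewrite !reD.
have -> : re (conjc b * g j i * a) = re (conjc a * g i j * b).
  by rewrite -re_conj !rmorphM /= conjcK -psd_conj_entry; congr re; ring.
rewrite (psd_diag i) (psd_diag j) /=.
have -> : forall (c : C) (r : R), conjc c * r%:C * c = (sqn c * r)%:C.
  by move=> c r; rewrite mulrAC mul_conjc_sqn -rmorphM.
have -> : forall (c : C) (r : R), conjc c * r%:C * c = (sqn c * r)%:C.
  by move=> c r; rewrite mulrAC mul_conjc_sqn -rmorphM.
rewrite /=; lra.
Qed.

Lemma psd_diag_ge0 i : 0 <= re (g i i).
Proof.
have := psd_form2 i i 1 0.
rewrite mulr0 /= mulr0 addr0 /sqn /= !expr0n !expr1n /=; lra.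
Qed.

(** Cauchy-Schwarz in weighted arithmetic-mean form, from the test vector [- t e_i + e_j]. The
    weight stays free: edges inside a block will use 1 and cut edges [th]. *)
Lemma psd_offdiag_le i j (t : R) : 0 < t ->
  2 * re (g i j) <= t * re (g i i) + re (g j j) / t.
Proof.
move=> t0; have := psd_form2 i j (- t%:C) 1.
have -> : re (conjc (- t%:C) * g i j * 1) = - (t * re (g i j)).
  by case: (g i j) => x y /=; ring.
have -> : sqn (- t%:C) = t ^+ 2 by rewrite /sqn /= oppr0 expr0n /= addr0 sqrrN.
have -> : sqn (1 : C) = 1 by rewrite /sqn /= expr0n expr1n addr0.
rewrite mul1r => h.
have : 0 <= (t ^+ 2 * re (g i i) + re (g j j) + 2 * - (t * re (g i j))) / t.
  by rewrite divr_ge0 // ltW.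
suff -> : (t ^+ 2 * re (g i i) + re (g j j) + 2 * - (t * re (g i j))) / t =
   t * re (g i i) + re (g j j) / t - 2 * re (g i j) by lra.
by field; rewrite gt_eqF.
Qed.

Lemma psd_zero_diag i j : g i i = 0 -> g i j = 0.
Proof.
move=> gi0; apply/eqP; rewrite -sqn_eq0; apply/negPn/negP => s0.
set s := sqn (g i j) in s0.
(* With [g i i = 0] the form is affine in the coefficient of [e_i]; this coefficient gives it the
   value [- g j j - 2], which is negative. *)
have := psd_form2 i j (- (((re (g j j) + 1) / s)%:C * g i j)) 1.
set u := (re (g j j) + 1) / s.
have -> : re (conjc (- (u%:C * g i j)) * g i j * 1) = - (u * s).
  by rewrite /s /sqn; case: (g i j) => x y /=; ring.
have -> : sqn (1 : C) = 1 by rewrite /sqn /= expr0n expr1n addr0.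
rewrite gi0 /= mulr0 add0r mul1r divfK //.
have := psd_diag_ge0 j; lra.
Qed.

End Psd.
End Matrices.

(** * Diagonalization and the Fermi projection *)
Section Spectral.
Context {R : realType}.
Local Notation C := R[i].

(** The columns of [ctr V] form an orthonormal eigenbasis, and [t] lists the eigenvalues as
    reals. *)
Definition diagonalizes n (V : 'M[C]_n) (t : 'I_n -> R) (A : 'M[C]_n) :=
  V *m ctr V = 1%:M /\ A = ctr V *m rdiag t *m V.

Lemma hermitian_diagonalizes n (A : 'M[C]_n) : Defs.hermitian A ->
  exists V t, diagonalizes V t A.
Proof.
move=> hA.
have cE m p (M : 'M[C]_(m, p)) : (M^t Num.conj)%sesqui = ctr M.
  by apply/matrixP => i j; rewrite !mxE.
have herm : A \is hermsymmx.
  by apply/is_hermitianmxP; rewrite expr0 scale1r cE hA.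
have /orthomx_spectralP E := hermitian_normalmx herm.
have uV := spectral_unitarymx A.
have /mxOverP dR := hermitian_spectral_diag_real herm.
exists (spectralmx A), (fun i => re (spectral_diag A 0 i)); split.
  by have /unitarymxP := uV; rewrite cE.
rewrite {1}E (invmx_unitary uV) cE; congr (_ *m _ *m _).
apply/matrixP => i j; rewrite !mxE; congr (_ *+ _).
by apply: conjc_fixed; apply/CrealP; exact: dR.
Qed.

(** The occupation number of the [i]-th eigenvector in the state [g]. *)
Definition occ n (V g : 'M[C]_n) i : R := re ((V *m g *m ctr V) i i).

Definition fermi n (V : 'M[C]_n) (t : 'I_n -> R) : 'M[C]_n :=
  ctr V *m rdiag (fun i => (t i < 0)%R%:R) *m V.

Section Diagonalized.
Context {n : nat} {V A : 'M[C]_n} {t : 'I_n -> R} (hV : diagonalizes V t A).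

Let VVc : V *m ctr V = 1%:M. Proof. by case: hV. Qed.
Let VcV : ctr V *m V = 1%:M. Proof. exact: mulmx1C. Qed.
Let AE : A = ctr V *m rdiag t *m V. Proof. by case: hV. Qed.

Lemma mul_diagonalizes : V *m A = rdiag t *m V.
Proof. by rewrite AE !mulmxA VVc mul1mx. Qed.

Lemma occ_ge0 g i : psd g -> 0 <= occ V g i.
Proof. by move=> hg; apply/psd_diag_ge0/psd_conj. Qed.

Lemma occ_le1 g i : admissible g -> occ V g i <= 1.
Proof.
move=> hg; have [_ /psd_diag_ge0 /(_ i)] := admissible_conj VVc hg.
have -> (M : 'M[C]_n) : (1%:M - M) i i = 1 - M i i by rewrite !mxE eqxx.
by rewrite reD reN subr_ge0.
Qed.

Lemma tr_diagonalizes g : psd g -> \tr (A *m g) = (\sum_i t i * occ V g i)%:C.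
Proof.
move=> hg; rewrite AE -!mulmxA mxtrace_mulC -!mulmxA /mxtrace rmorph_sum /=.
apply: eq_bigr => i _; rewrite rdiag_mul rmorphM /=; congr (_ * _).
by rewrite mulmxA [LHS](psd_diag (psd_conj V hg)).
Qed.

(** The excess over the filled Fermi sea splits into the cost of holes at negative levels and of
    particles at the others. Keeping the terms separate serves both the case of equality and the
    quantitative gain in [segregation]. *)
Lemma bathtub g : \sum_i t i * occ V g i - \sum_(i | t i < 0) t i =
  \sum_i (if t i < 0 then - t i * (1 - occ V g i) else t i * occ V g i).
Proof.
rewrite [X in _ - X]big_mkcond -sumrB; apply: eq_bigr => i _.
by case: ifP => _; ring.
Qed.

Lemma bathtub_ge g i : admissible g ->
  0 <= (if t i < 0 then - t i * (1 - occ V g i) else t i * occ V g i).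
Proof.
move=> hg; have o1 := occ_le1 i hg; have o0 := occ_ge0 i hg.1.
case: ltP => ti; apply: mulr_ge0 => //; lra.
Qed.

Lemma bathtub_le g : admissible g ->
  \sum_(i | t i < 0) t i <= \sum_i t i * occ V g i.
Proof.
move=> hg; rewrite -subr_ge0 bathtub; apply: sumr_ge0 => i _; exact: bathtub_ge.
Qed.

Lemma psd_rdiag (s : 'I_n -> R) : (forall i, 0 <= s i) -> psd (ctr V *m rdiag s *m V).
Proof.
move=> s0; rewrite -{2}[V]ctrK; apply: psd_conj; split; first exact: ctr_rdiag.
move=> v; rewrite -mulmxA mxE sumr_ge0 // => i _.
rewrite rdiag_mul ctrE mulrCA mul_conjc_sqn -rmorphM lecR.
by rewrite mulr_ge0 // sqn_ge0.
Qed.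

Lemma fermi_admissible : admissible (fermi V t).
Proof.
split; first by apply: psd_rdiag => i; case: (_ < _).
have -> : 1%:M - fermi V t = ctr V *m rdiag (fun i => (~~ (t i < 0))%R%:R) *m V.
  have E1 : 1%:M = ctr V *m 1%:M *m V by rewrite mulmx1 VcV.
  rewrite {1}E1 /fermi -mulmxBl -mulmxBr; congr (_ *m _ *m _).
  apply/matrixP => i j; rewrite !mxE; case: eqP => _; rewrite ?mulr0n ?subr0 //.
  by case: (_ < _); rewrite /= !mulr1n ?subr0 ?subrr.
by apply: psd_rdiag => i; case: (_ < _).
Qed.

Lemma occ_fermi i : occ V (fermi V t) i = (t i < 0)%R%:R.
Proof.
rewrite /occ /fermi !mulmxA VVc mul1mx -mulmxA VVc mulmx1.
by rewrite rdiagE eqxx mulr1n.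
Qed.

Lemma occ_fermi_sum : \sum_i t i * occ V (fermi V t) i = \sum_(i | t i < 0) t i.
Proof.
rewrite [RHS]big_mkcond; apply: eq_bigr => i _; rewrite occ_fermi.
by case: ifP => _; rewrite (mulr1, mulr0).
Qed.

Lemma tr_fermi : \tr (A *m fermi V t) = (\sum_(i | t i < 0) t i)%:C.
Proof. by rewrite tr_diagonalizes ?occ_fermi_sum //; case: fermi_admissible. Qed.

(** Unitary conjugation preserves the characteristic polynomial, and unique factorization makes any
    sequence of its roots a permutation of [t]. *)
Lemma trneg_diagonalizes : trneg A = (\sum_(i | t i < 0) t i)%:C.
Proof.
have cp : char_poly A = \prod_(x <- [seq (t i)%:C | i : 'I_n]) ('X - x%:P).
  rewrite big_image /=.
  transitivity (char_poly (rdiag t)).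
    rewrite /char_poly /char_poly_mx AE !map_mxM.
    set W := map_mx polyC V; set W' := map_mx polyC (ctr V).
    have WW : W' *m W = 1%:M by rewrite -map_mxM VcV map_mx1.
    have -> : 'X%:M - W' *m map_mx polyC (rdiag t) *m W =
       W' *m ('X%:M - map_mx polyC (rdiag t)) *m W.
      rewrite mulmxBr mulmxBl; congr (_ - _).
      by rewrite scalar_mxC -mulmxA WW mulmx1.
    by rewrite !det_mulmx mulrAC -det_mulmx WW det1 mul1r.
  rewrite char_poly_trig; last first.
    by apply: diag_mx_is_trig.
  by apply: eq_bigr => i _; rewrite rdiagE eqxx.
rewrite /trneg /eigen_seq; case: closed_field_poly_normal => s /= sE.
have ps : perm_eq s [seq (t i)%:C | i : 'I_n].
  apply: prod_XsubC_eq; rewrite -cp {}sE.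
  by rewrite (eqP (char_poly_monic A)) scale1r.
rewrite (perm_big _ ps) big_image_cond /= rmorph_sum /=; apply: eq_bigl => i.
by rewrite ltcR.
Qed.

(* Matrices commuting with [A] are block diagonal for its eigenvalues, hence commute with
   every function of [A]. *)
Lemma fermi_comm (l : 'I_n -> R) : rdiag l *m A = A *m rdiag l ->
  rdiag l *m fermi V t = fermi V t *m rdiag l.
Proof.
have [B BE] : exists B, rdiag l = ctr V *m B *m V.
  exists (V *m rdiag l *m ctr V).
  by rewrite !mulmxA VcV mul1mx -mulmxA VcV mulmx1.
move=> h.
have conjM (X Y : 'M[C]_n) : ctr V *m X *m V *m (ctr V *m Y *m V) = ctr V *m (X *m Y) *m V.
  by rewrite !mulmxA -(mulmxA _ V) VVc mulmx1.
have conj_inj (X Y : 'M[C]_n) : ctr V *m X *m V = ctr V *m Y *m V -> X = Y.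
  move=> /(congr1 (fun M => V *m M *m ctr V)).
  by rewrite !mulmxA VVc !mul1mx -!mulmxA VVc !mulmx1.
have hB : B *m rdiag t = rdiag t *m B.
  by apply: conj_inj; rewrite -!conjM -BE -AE h.
have hB' : B *m rdiag (fun i => (t i < 0)%R%:R) = rdiag (fun i => (t i < 0)%R%:R) *m B.
  apply/matrixP => i j; have := congr1 (fun M : 'M[C]_n => M i j) hB.
  rewrite /= !mul_rdiag !rdiag_mul (mulrC _ (B i j)).
  have [->|Bij] := eqVneq (B i j) 0; first by rewrite !(mulr0, mul0r).
  by move=> /(mulfI Bij) [->]; rewrite mulrC.
by rewrite /fermi BE !conjM hB'.
Qed.

(** A zero on the diagonal of [g] kills its row; a one does the same for the positive matrix
    [1 - g]. *)
Lemma admissible_sharp m (g : 'M[C]_m) (b : 'I_m -> bool) : admissible g ->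
  (forall i, re (g i i) = (b i)%:R) -> g = rdiag (fun i => (b i)%:R).
Proof.
case=> g1 g2 h; apply/matrixP => i j; rewrite rdiagE.
have gi : g i i = (b i)%:R%:C by rewrite (psd_diag g1) h.
case: eqVneq => [<-|ij]; first by rewrite mulr1n.
rewrite mulr0n; case: (b i) gi => gi; last exact: (psd_zero_diag g1).
have := psd_zero_diag (i := i) (g := 1%:M - g) g2 j.
rewrite !mxE eqxx (negbTE ij) gi subrr => /(_ erefl) /eqP.
by rewrite sub0r oppr_eq0 => /eqP.
Qed.

(** Every term of the bathtub excess vanishes, so each occupation number is 0 or 1. At a level
    [t i = 0] the occupation would be free. *)
Lemma fermi_unique g : admissible g -> (forall i, t i != 0) ->
  \sum_i t i * occ V g i = \sum_(i | t i < 0) t i -> g = fermi V t.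
Proof.
move=> hg t0 /eqP; rewrite -subr_eq0 bathtub psumr_eq0; last first.
  by move=> i _; exact: bathtub_ge.
move=> /allP h.
have E i : occ V g i = (t i < 0)%R%:R.
  have := h i (mem_index_enum _); have := t0 i; case: ifP => _ ti /=.
    by rewrite mulf_eq0 oppr_eq0 (negbTE ti) /= subr_eq0 => /eqP <-.
  by rewrite mulf_eq0 (negbTE ti) => /eqP.
have := admissible_sharp (admissible_conj VVc hg) E.
move=> /(congr1 (fun M => ctr V *m M *m V)).
by rewrite !mulmxA VcV mul1mx -mulmxA VcV mulmx1.
Qed.

(** In the eigenbasis of [A] only coordinates with [t i = a] can be nonzero, and on those the signs
    of [t i] and [a] agree. *)
Lemma fermi_eigen (a : C) (v : 'cV[C]_n) : A *m v = a *: v ->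
  fermi V t *m v = if a < 0 then v else 0.
Proof.
move=> h; have hw : rdiag t *m (V *m v) = a *: (V *m v).
  by rewrite mulmxA -mul_diagonalizes -mulmxA h scalemxAr.
set w := V *m v in hw *.
have E : rdiag (fun i => (t i < 0)%R%:R) *m w = (a < 0)%R%:R *: w.
  apply/matrixP => i j; have hi : (t i)%:C * w i j = a * w i j.
    by rewrite -rdiag_mul hw [LHS]mxE.
  rewrite rdiag_mul [RHS]mxE; have [->|wi] := eqVneq (w i j) 0; first by rewrite !mulr0.
  by rewrite -(mulIf wi hi) ltcR rmorph_nat.
rewrite /fermi -!mulmxA E -scalemxAr mulmxA VcV mul1mx.
by case: (a < 0); rewrite (scale1r, scale0r).
Qed.

Lemma quad_diagonalizes (v : 'cV[C]_n) : (ctr v *m A *m v) 0 0 =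
  (\sum_i t i * sqn ((V *m v) i 0))%:C.
Proof.
rewrite AE -!mulmxA mulmxA -ctrM mxE rmorph_sum; apply: eq_bigr => i _.
by rewrite rdiag_mul ctrE mulrCA mul_conjc_sqn -rmorphM.
Qed.

Lemma sum_sqn_diagonalizes (v : 'cV[C]_n) :
  \sum_i sqn ((V *m v) i 0) = \sum_i sqn (v i 0).
Proof.
apply: (@CC_inj R); rewrite -!ctr_mul_self ctrM.
by rewrite -mulmxA (mulmxA _ V) VcV mul1mx.
Qed.

Lemma eigenvalue_diagonalizes i : eigenvalue A (t i)%:C.
Proof.
apply/eigenvalueP; exists (row i V).
  rewrite -row_mul mul_diagonalizes; apply/rowP => j.
  by rewrite [LHS]mxE rdiag_mul !mxE.
apply/eqP => /(congr1 (fun r => r *m ctr V)); rewrite -row_mul VVc mul0mx.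
by move=> /rowP /(_ i); rewrite !mxE eqxx => /eqP; rewrite oner_eq0.
Qed.

End Diagonalized.
End Spectral.

(** * The segregation estimate *)
Section Hopping.
Context {R : realType} {n : nat}.
Local Notation C := R[i].

Definition relmx (c : rel 'I_n) : 'M[C]_n := \matrix_(i, j) (c i j)%:R.
Definition reldeg (c : rel 'I_n) x : R := \sum_y (c x y)%:R.
(** For [a = D - mu] on a [D]-regular graph this is minus the graph Laplacian, shifted by [- mu].
    The diagonal is a separate parameter because deleting edges leaves it unchanged, which acts like
    a Dirichlet condition along the cut. *)
Definition ham (a : R) (c : rel 'I_n) : 'M[C]_n := (a%:C)%:M - relmx c.

Lemma reldeg_ge0 c x : 0 <= reldeg c x.
Proof. by apply: sumr_ge0 => y _; rewrite ler0n. Qed.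

Lemma relmx_hermitian c : symmetric c -> Defs.hermitian (relmx c).
Proof. by move=> s; apply/matrixP => i j; rewrite ctrE !mxE s rmorph_nat. Qed.

Lemma ham_hermitian a c : symmetric c -> Defs.hermitian (ham a c).
Proof.
move=> s; rewrite /Defs.hermitian /ham ctrD ctrN relmx_hermitian //; congr (_ - _).
apply/matrixP => i j; rewrite ctrE !mxE eq_sym; case: eqP => _.
  by rewrite !mulr1n conjc_real.
by rewrite !mulr0n rmorph0.
Qed.

Lemma re_conj_mul_bounds (u v : C) :
  - ((sqn u + sqn v) / 2) <= re (conjc u * v) <= (sqn u + sqn v) / 2.
Proof.
case: u v => a b [c e]; rewrite /sqn /=.
have := sqr_ge0 (a - c); have := sqr_ge0 (b - e).
have := sqr_ge0 (a + c); have := sqr_ge0 (b + e).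
by move=> h1 h2 h3 h4; apply/andP; split; nra.
Qed.

Lemma quad_ham a c (v : 'cV[C]_n) : re ((ctr v *m ham a c *m v) 0 0) =
  a * (\sum_x sqn (v x 0)) -
  \sum_x \sum_y (c x y)%:R * re (conjc (v x 0) * v y 0).
Proof.
rewrite /ham mulmxBr mulmxBl.
have -> : forall M N : 'M[C]_1, (M - N) 0 0 = M 0 0 - N 0 0 by move=> M N; rewrite !mxE.
rewrite reD reN; congr (_ - _).
  rewrite scalar_mxC -mulmxA mul_scalar_mx.
  have -> (M : 'M[C]_1) : (a%:C *: M) 0 0 = a%:C * M 0 0 by rewrite mxE.
  by rewrite ctr_mul_self reCM.
rewrite -mulmxA mxE re_sum; apply: eq_bigr => x _.
rewrite ctrE mxE mulr_sumr re_sum; apply: eq_bigr => y _.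
rewrite mxE mulrCA; case: (c x y); first by rewrite !mul1r.
by rewrite !mul0r.
Qed.

(** Both orientations of an edge are summed, so each end collects one full weight per incident
    edge. *)
Lemma sum_rel_half c (f : 'I_n -> R) : symmetric c ->
  \sum_x \sum_y (c x y)%:R * ((f x + f y) / 2) = \sum_x reldeg c x * f x.
Proof.
move=> s; transitivity
  (\sum_x \sum_y ((c x y)%:R * f x / 2) + \sum_x \sum_y ((c x y)%:R * f y / 2)).
  rewrite -big_split; apply: eq_bigr => x _; rewrite -big_split.
  by apply: eq_bigr => y _ /=; lra.
rewrite [X in _ + X]exchange_big -big_split; apply: eq_bigr => x _ /=.
rewrite -big_split mulr_suml; apply: eq_bigr => y _ /=.
by rewrite (s y x); lra.
Qed.

(** Diagonal dominance: a hopping term is at most the mean of the squared moduli at its ends. *)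
Lemma quad_ham_ge a c (v : 'cV[C]_n) : symmetric c ->
  \sum_x (a - reldeg c x) * sqn (v x 0) <= re ((ctr v *m ham a c *m v) 0 0).
Proof.
move=> s; rewrite quad_ham.
under eq_bigr do rewrite mulrBl; rewrite big_split sumrN -mulr_sumr lerD2l lerN2 /=.
rewrite -sum_rel_half //; apply: ler_sum => x _; apply: ler_sum => y _.
by rewrite ler_wpM2l ?ler0n //; have /andP[] := re_conj_mul_bounds (v x 0) (v y 0).
Qed.

Lemma quad_ham_le a c (v : 'cV[C]_n) : symmetric c ->
  re ((ctr v *m ham a c *m v) 0 0) <= \sum_x (a + reldeg c x) * sqn (v x 0).
Proof.
move=> s; rewrite quad_ham.
under [X in _ <= X]eq_bigr do rewrite mulrDl.
rewrite [X in _ <= X]big_split /=; rewrite -mulr_sumr lerD2l -sumrN.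
rewrite -sum_rel_half //; apply: ler_sum => x _; rewrite -sumrN; apply: ler_sum => y _.
rewrite -mulrN ler_wpM2l ?ler0n // lerNl.
by have /andP[] := re_conj_mul_bounds (v x 0) (v y 0).
Qed.

Lemma diagonalizes_quad (V A : 'M[C]_n) t i : diagonalizes V t A ->
  exists v : 'cV[C]_n, \sum_x sqn (v x 0) = 1 /\ re ((ctr v *m A *m v) 0 0) = t i.
Proof.
move=> h; have [VVc _] := h.
have E j : sqn ((V *m (ctr V *m delta_mx i 0 : 'cV[C]_n)) j 0) = (j == i)%:R.
  rewrite mulmxA VVc mul1mx mxE eqxx andbT.
  by case: eqP => _; rewrite /sqn /= ?expr1n !expr0n /= addr0.
exists (ctr V *m delta_mx i 0); split.
  rewrite -(sum_sqn_diagonalizes h); under eq_bigr do rewrite E.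
  by rewrite (bigD1 i) //= eqxx big1 ?addr0 // => j /negbTE ->.
rewrite (quad_diagonalizes h) /=; under eq_bigr do rewrite E.
by rewrite (bigD1 i) //= eqxx mulr1 big1 ?addr0 // => j /negbTE ->; rewrite mulr0.
Qed.

End Hopping.

(** * Energy gained by cutting edges between blocks *)

Section Segregation.
Context {R : realType} {n : nat} (D : nat) (mu : R) (e : rel 'I_n).
Local Notation C := R[i].
Hypotheses (e_sym : symmetric e) (e_deg : forall x, reldeg e x = D%:R :> R).
Hypotheses (D_gt0 : (0 < D)%N) (mu_gt0 : 0 < mu) (mu_le : mu <= 1 / 2).
Variable l : 'I_n -> nat.

Definition cutrel : rel 'I_n := fun x y => e x y && (l x != l y).
Definition uncutrel : rel 'I_n := fun x y => e x y && (l x == l y).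

Lemma cut_sym : symmetric cutrel.
Proof. by move=> x y; rewrite /cutrel e_sym eq_sym. Qed.
Lemma uncut_sym : symmetric uncutrel.
Proof. by move=> x y; rewrite /uncutrel e_sym eq_sym. Qed.

Lemma reldeg_uncut x : reldeg uncutrel x = D%:R - reldeg cutrel x :> R.
Proof.
apply/eqP; rewrite eq_sym subr_eq -(e_deg x) -big_split; apply/eqP.
apply: eq_bigr => y _; rewrite /uncutrel /cutrel.
by case: (e x y); case: (_ == _); rewrite /= ?addr0 ?add0r.
Qed.

Local Notation A := (ham (D%:R - mu) uncutrel).
Local Notation K := (ham (D%:R - mu) e).

Lemma ham_uncut : A = K + relmx cutrel.
Proof.
rewrite /ham -addrA; congr (_ + _); apply/matrixP => i j; rewrite !mxE /uncutrel /cutrel.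
by case: (e i j); case: (_ == _); rewrite /= ?oppr0 ?addr0 ?addNr.
Qed.

Lemma ham_uncut_spectrum V t i : diagonalizes V t A -> - mu <= t i <= 2 * D%:R - mu.
Proof.
move=> h; have [v [v1 <-]] := diagonalizes_quad i h.
have := quad_ham_ge (D%:R - mu) v uncut_sym.
have := quad_ham_le (D%:R - mu) v uncut_sym.
have E z : z = \sum_x z * sqn (v x 0) by rewrite -mulr_sumr v1 mulr1.
move=> h1 h2; apply/andP; split.
  apply: le_trans h2; rewrite [X in X <= _]E; apply: ler_sum => x _.
  rewrite ler_wpM2r ?sqn_ge0 // reldeg_uncut.
  by have := @reldeg_ge0 R n cutrel x; lra.
apply: le_trans h1 _; rewrite [X in _ <= X]E; apply: ler_sum => x _.
rewrite ler_wpM2r ?sqn_ge0 // reldeg_uncut.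
by have := @reldeg_ge0 R n cutrel x; lra.
Qed.

(* [A] commutes with the diagonal matrix of the block labels, hence so does its Fermi
   projection. *)
Lemma fermi_block V t x y : diagonalizes V t A -> l x != l y -> fermi V t x y = 0.
Proof.
move=> h lxy; have := fermi_comm h (l := fun i => (l i)%:R).
have -> : rdiag (fun i => (l i)%:R) *m A = A *m rdiag (fun i => (l i)%:R).
  apply/matrixP => i j; rewrite rdiag_mul mul_rdiag mulrC !mxE.
  case: eqVneq => [->//|ij]; rewrite /uncutrel; case: (e i j) => /=.
    by case: eqP => [->//|_]; rewrite subrr !mul0r.
  by rewrite subrr !mul0r.
move=> /(_ erefl) /matrixP /(_ x y); rewrite rdiag_mul mul_rdiag mulrC => /eqP.
rewrite -subr_eq0 -mulrBr mulf_eq0 => /orP[/eqP//|].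
by rewrite -rmorphB /= -(rmorph0 (real_complex R)) (inj_eq (@CC_inj R)) subr_eq0
  eqr_nat (negbTE lxy).
Qed.

(** For [d < 0] the factor [2 * (1 - mu - d)] is at least 1 because [mu <= 1 / 2]. For [d >= 0] both
    [d - t] and [d + mu] are at most [2 * D], so [16 * D ^ 3] covers the term
    [2 * (d + mu) * (d - t) ^ 2]. *)
Lemma spectral_gap_bound (d t : R) : - mu <= d <= 2 * D%:R - mu -> - mu <= t <= 0 ->
  (d - t) ^+ 2 <= 2 * ((1 - mu) * (d - t) ^+ 2 - d * (d - t) ^+ 2)
     + 16 * D%:R ^+ 3 * (0 <= d)%R%:R.
Proof.
have D1 : 1 <= D%:R :> R by rewrite ler1n.
move=> /andP[d1 d2] /andP[t1 t2]; have s0 := sqr_ge0 (d - t).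
case: (leP 0 d) => d0; rewrite ?mulr1 ?mulr0 ?addr0; last first.
  have : 0 <= (d - t) ^+ 2 * (1 - 2 * mu - 2 * d) by apply: mulr_ge0 => //; move: mu_le d0; lra.
  lra.
have h : (d - t) ^+ 2 <= (2 * D%:R) ^+ 2 by rewrite ler_sqr ?nnegrE; lra.
have h2 : (d - t) ^+ 2 * (2 * (d + mu)) <= (2 * D%:R) ^+ 2 * (4 * D%:R).
  by apply: ler_pM => //; lra.
have -> : 16 * D%:R ^+ 3 = (2 * D%:R) ^+ 2 * (4 * D%:R) :> R by ring.
lra.
Qed.

Variables (W : 'M[C]_n) (t : 'I_n -> R) (S : pred 'I_n).
Hypothesis W_diag : diagonalizes W t K.
Hypothesis t_S : forall k, S k -> - mu <= t k <= - (mu / 2).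
(** The phases of a low plane wave nearly agree at the neighbours of a site, so the deleted hops
    cannot cancel. *)
Hypothesis W_S : forall k, S k -> forall x,
  3 / 4 * reldeg cutrel x / n%:R <= sqn (\sum_y (cutrel x y)%:R * ctr W y k).

(** The gain per oriented cut edge: a hole in a mode of [S] costs at least [mu / 2], and the
    remaining factor is the bound of [hole_bound] summed over [S]. *)
Definition seg_const : R := mu / 2 * (3 / 4 * (\sum_(k | S k) 1) / n%:R) / (16 * D%:R ^+ 3).

(* [spectral_gap_bound] is integrated against the spectral measure of the plane wave. *)
Lemma hole_bound V d k : diagonalizes V d A -> S k ->
  3 / 4 * (\sum_x reldeg cutrel x) / n%:R <=
    16 * D%:R ^+ 3 * (1 - occ W (fermi V d) k).
Proof.
move=> hV Sk; have [VVc VE] := hV; have [WWc WE] := W_diag.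
pose X := V *m ctr W; pose B := relmx cutrel *m ctr W.
have BE x : B x k = \sum_y (cutrel x y)%:R * ctr W y k.
  by rewrite mxE; apply: eq_bigr => y _; rewrite mxE.
(* Column [k] of [B] is [A - t k] applied to the plane wave, hence the factor [d i - t k] in the
   eigenbasis of [A]. *)
have VBE i : (V *m B) i k = (d i - t k)%:C * X i k.
  have -> : V *m B = rdiag d *m X - X *m rdiag t.
    have WK : K *m ctr W = ctr W *m rdiag t.
      have := congr1 ctr (mul_diagonalizes W_diag).
      by rewrite !ctrM ctr_rdiag (ham_hermitian _ e_sym).
    have -> : B = A *m ctr W - ctr W *m rdiag t.
      by rewrite ham_uncut mulmxDl WK addrC addKr.
    by rewrite mulmxBr mulmxA (mul_diagonalizes hV) /X !mulmxA.
  rewrite -[LHS]/((rdiag d *m X + - (X *m rdiag t)) i k).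
  have -> : forall M N : 'M[C]_n, (M - N) i k = M i k - N i k by move=> M N; rewrite !mxE.
  by rewrite rdiag_mul mul_rdiag (mulrC (X i k)) -mulrBl rmorphB.
pose s i := sqn (X i k).
have s0 i : 0 <= s i by exact: sqn_ge0.
have s1 : \sum_i s i = 1.
  apply: (@CC_inj R); rewrite -ctr_mul_self /X ctrM ctrK.
  rewrite -mulmxA (mulmxA _ V) (mulmx1C VVc) mul1mx WWc.
  by rewrite mxE eqxx.
have occE : occ W (fermi V d) k = \sum_i (d i < 0)%R%:R * s i.
  rewrite /occ.
  have -> : W *m fermi V d *m ctr W = ctr X *m rdiag (fun i => (d i < 0)%R%:R) *m X.
    by rewrite /X ctrM ctrK /fermi !mulmxA.
  rewrite -mulmxA mxE re_sum; apply: eq_bigr => i _.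
  by rewrite ctrE rdiag_mul mulrCA mul_conjc_sqn reCM.
have holeE : 1 - occ W (fermi V d) k = \sum_i (0 <= d i)%R%:R * s i.
  rewrite occE -[X in X - _]s1 -sumrB; apply: eq_bigr => i _.
  by case: (ltP (d i) 0) => _; rewrite ?mul1r ?mul0r ?subr0 ?subrr.
pose v := col k B.
have Vv i : sqn ((V *m v) i 0) = (d i - t k) ^+ 2 * s i.
  by rewrite /v colE mulmxA -colE mxE VBE sqnM sqnC.
have vE x : v x 0 = B x k by rewrite mxE.
have nv : \sum_i (d i - t k) ^+ 2 * s i = \sum_x sqn (v x 0).
  by rewrite -(sum_sqn_diagonalizes hV); apply: eq_bigr => i _; rewrite Vv.
have quad : (1 - mu) * \sum_x sqn (v x 0) <= \sum_i d i * ((d i - t k) ^+ 2 * s i).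
  have -> : \sum_i d i * ((d i - t k) ^+ 2 * s i) = re ((ctr v *m A *m v) 0 0).
    by rewrite (quad_diagonalizes hV) /=; apply: eq_bigr => i _; rewrite Vv.
  apply: (le_trans _ (quad_ham_ge (D%:R - mu) v uncut_sym)).
  rewrite mulr_sumr; apply: ler_sum => x _; rewrite vE BE reldeg_uncut.
  (* [v] vanishes where no edge is cut; elsewhere the uncut degree is at most [D - 1], so the
     diagonal excess is at least [1 - mu]. *)
  have [c0|c0] := eqVneq (reldeg cutrel x : R) 0.
    rewrite big1 ?/sqn /= ?expr0n /= ?addr0 ?mulr0 // => y _.
    have : (cutrel x y)%:R <= reldeg cutrel x :> R.
      by rewrite /reldeg (bigD1 y) //= lerDl sumr_ge0 // => z _; rewrite ler0n.
    by rewrite c0; case: (cutrel x y); rewrite ?mul0r //= ler10.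
  rewrite ler_wpM2r ?sqn_ge0 //.
  suff : 1 <= reldeg cutrel x :> R by lra.
  by move: c0; rewrite /reldeg -natr_sum pnatr_eq0 ler1n -lt0n.
have main : \sum_x sqn (v x 0) <= 16 * D%:R ^+ 3 * (1 - occ W (fermi V d) k).
  apply: (@le_trans _ _ (2 * ((1 - mu) * \sum_x sqn (v x 0)
     - \sum_i d i * ((d i - t k) ^+ 2 * s i)) + 16 * D%:R ^+ 3 * (1 - occ W (fermi V d) k))).
    rewrite -nv holeE !mulr_sumr -sumrB mulr_sumr -big_split.
    apply: ler_sum => i _ /=.
    have := ler_wpM2r (s0 i) (@spectral_gap_bound (d i) (t k) (ham_uncut_spectrum i hV) _).
    have /andP[t1 t2] := t_S Sk => h.
    apply: le_trans (h _) _; first by apply/andP; split; lra.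
    by rewrite le_eqVlt; apply/orP; left; apply/eqP; ring.
  by lra.
apply: le_trans main.
rewrite mulr_sumr mulr_suml; apply: ler_sum => x _; rewrite vE BE; exact: W_S.
Qed.

(** [A] and [K] differ only on cut edges, where the block-diagonal Fermi projection of [A] has zero
    entries. *)
Lemma tr_fermi_uncut V d : diagonalizes V d A ->
  \tr (A *m fermi V d) = \tr (K *m fermi V d).
Proof.
move=> hV; rewrite ham_uncut mulmxDl mxtraceD [X in _ + X](_ : _ = 0) ?addr0 //.
rewrite /mxtrace big1 // => x _; rewrite mxE big1 // => y _.
rewrite mxE /cutrel; case: eqVneq => [_|lxy]; first by rewrite andbF mul0r.
by rewrite (fermi_block hV) ?mulr0 // eq_sym.
Qed.

(** The Fermi sea of [A] serves as a trial state for [K], with the same energy. Its bathtub excess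
    for [K] is at least the cost of its holes in the modes of [S]. *)
Lemma segregation V d : diagonalizes V d A ->
  \sum_(i | t i < 0) t i + seg_const * (\sum_x reldeg cutrel x) <= \sum_(i | d i < 0) d i.
Proof.
move=> hV; have hP := fermi_admissible hV.
have -> : \sum_(i | d i < 0) d i = \sum_i t i * occ W (fermi V d) i.
  apply: (@CC_inj R); rewrite -(tr_fermi hV) tr_fermi_uncut //.
  by rewrite (tr_diagonalizes W_diag) //; case: hP.
rewrite -lerBrDl (bathtub (t := t)).
rewrite [X in _ <= X](bigID S) /=; apply: ler_wpDr.
  by apply: sumr_ge0 => i _; exact: (bathtub_ge W_diag i hP).
have -> : seg_const * (\sum_x reldeg cutrel x) = \sum_(k | S k) (mu / 2) *
    ((3 / 4 * (\sum_x reldeg cutrel x) / n%:R) / (16 * D%:R ^+ 3)).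
  rewrite -[RHS]mulr_sumr -[X in _ = mu / 2 * X]mulr1; rewrite /seg_const.
  rewrite -(mulr1 (_ / (16 * D%:R ^+ 3))) -mulr_sumr; ring.
have mu0 := mu_gt0; apply: ler_sum => k Sk; have /andP[t1 t2] := t_S Sk.
rewrite ifT; last by lra.
have D0 : 0 < 16 * D%:R ^+ 3 :> R by rewrite mulr_gt0 // exprn_gt0 // ltr0n.
apply: ler_pM; rewrite ?divr_ge0 //; first lra.
- by rewrite mulr_ge0 // sumr_ge0 // => x _; exact: reldeg_ge0.
- lra.
rewrite ler_pdivrMr // [X in _ <= X]mulrC; exact: (hole_bound hV Sk).
Qed.

End Segregation.

(** * The energy of two density matrices *)
Section Compression.
Context {R : realType} {n : nat}.
Local Notation C := R[i].

Definition mask (a : pred 'I_n) : 'M[C]_n := rdiag (fun i => (a i)%:R).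
Definition compress (a : pred 'I_n) (g : 'M[C]_n) : 'M[C]_n := mask a *m g *m mask a.

Lemma compressE a g i j : compress a g i j = g i j *+ (a i && a j).
Proof.
rewrite /compress /mask mul_rdiag rdiag_mul.
by case: (a i); case: (a j); rewrite ?mul1r ?mul0r ?mulr1 ?mulr0.
Qed.

Lemma psd_add (g h : 'M[C]_n) : psd g -> psd h -> psd (g + h).
Proof.
case=> g1 g2 [h1 h2]; split; first by rewrite /Defs.hermitian ctrD g1 h1.
by move=> v; rewrite mulmxDr mulmxDl mxE addr_ge0.
Qed.

Lemma psd_compress a (g : 'M[C]_n) : psd g -> psd (compress a g).
Proof. by move=> hg; rewrite /compress -{2}[mask a]ctr_rdiag; exact: psd_conj. Qed.

Lemma psd1 : psd (1%:M : 'M[C]_n).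
Proof.
split; first exact: ctr1.
by move=> v; rewrite mulmx1 ctr_mul_self lecR sumr_ge0 // => i _; exact: sqn_ge0.
Qed.

(** On disjoint regions the two spins merge into one spinless density matrix. Its complement is the
    sum of the compressed complements and the projection onto the sites of neither region. *)
Lemma compress_admissible (a b : pred 'I_n) g h : (forall x, ~~ (a x && b x)) ->
  admissible g -> admissible h -> admissible (compress a g + compress b h).
Proof.
move=> dis [g1 g2] [h1 h2]; split; first by apply: psd_add; apply: psd_compress.
have -> : 1%:M - (compress a g + compress b h) =
  compress a (1%:M - g) + compress b (1%:M - h) +
  compress (predC (predU a b)) 1%:M.
  have addE (M N : 'M[C]_n) i j : (M + N) i j = M i j + N i j by rewrite mxE.
  have oppE (M : 'M[C]_n) i j : (- M) i j = - M i j by rewrite mxE.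
  apply/matrixP => i j; rewrite !(addE, oppE, compressE).
  have -> : (1%:M : 'M[C]_n) i j = (i == j)%:R by rewrite mxE.
  have := dis i; have := dis j; rewrite /= /in_mem /=.
  case: eqVneq => [->|ij].
    by case: (a j); case: (b j) => //= _ _; rewrite !(mulr0n, mulr1n); ring.
  by case: (a i); case: (a j); case: (b i); case: (b j) => //= _ _;
    rewrite !(mulr0n, mulr1n); ring.
exact: psd_add (psd_add (psd_compress _ g2) (psd_compress _ h2)) (psd_compress _ psd1).
Qed.

Lemma re_tr_ham (a : R) (c : rel 'I_n) (g : 'M[C]_n) : psd g ->
  re (\tr (ham a c *m g)) =
    \sum_x a * re (g x x) - \sum_x \sum_y (c x y)%:R * re (g x y).
Proof.
move=> hg; rewrite /ham mulmxBl /mxtrace re_sum -sumrB; apply: eq_bigr => x _.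
have -> : forall M N : 'M[C]_n, (M - N) x x = M x x - N x x by move=> M N; rewrite !mxE.
rewrite reD reN mul_scalar_mx; congr (_ - _).
  have -> : (a%:C *: g) x x = a%:C * g x x by rewrite mxE.
  exact: reCM.
rewrite mxE re_sum; apply: eq_bigr => y _; rewrite mxE.
rewrite (psd_conj_entry hg y x); case: (c x y); last by rewrite !mul0r.
by rewrite !mul1r re_conj.
Qed.

End Compression.

(** * Hopping energy lost by compression *)

Section HoppingCost.
Context {R : realType} {n : nat} (D : nat) (mu : R) (e : rel 'I_n).
Local Notation C := R[i].
Hypotheses (e_sym : symmetric e) (e_deg : forall x, reldeg e x = D%:R :> R).
Variables (l : 'I_n -> nat) (a : pred 'I_n) (g : 'M[C]_n) (th : R).
Hypotheses (a_l : forall x y, a x -> a y -> l x = l y)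
  (l_a : forall x y, e x y -> l x = l y -> a x = a y).
Hypotheses (g_adm : admissible g) (th_gt0 : 0 < th).
Local Notation K := (ham (D%:R - mu) e).
Local Notation A := (ham (D%:R - mu) (uncutrel e l)).
Local Notation r x := (re (g x x)).
Local Notation nc x := (reldeg (cutrel e l) x : R).

Lemma admissible_diag_le1 x : re (g x x) <= 1.
Proof.
case: g_adm => _ /psd_diag_ge0 /(_ x); rewrite !mxE eqxx reD reN /=; lra.
Qed.

(** The estimate is made edge by edge. An uncut edge lies inside [a], where it is kept, or outside,
    where it costs the mean density of its ends; that cost is absorbed by the diagonal and leaves
    [nc - mu]. A cut edge has an end outside [a], which is charged [th + r / th]. *)
Lemma hopping_cost :
  re (\tr (A *m compress a g)) +
    \sum_(x | ~~ a x) ((nc x - mu) * r x - nc x * (th + r x / th))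
  <= re (\tr (K *m g)).
Proof.
have g0 := psd_diag_ge0 g_adm.1.
rewrite !re_tr_ham; [|exact: g_adm.1|by apply: psd_compress; exact: g_adm.1].
pose f x := (~~ a x)%:R * r x.
pose h x := (~~ a x)%:R * (th + r x / th).
have h0 x : 0 <= h x.
  by rewrite mulr_ge0 ?ler0n // addr_ge0 ?divr_ge0 // ltW.
have hop : \sum_x \sum_y (e x y)%:R * re (g x y) <=
    \sum_x \sum_y (uncutrel e l x y)%:R * re (compress a g x y) +
    \sum_x \sum_y (uncutrel e l x y)%:R * ((f x + f y) / 2) +
    \sum_x \sum_y (cutrel e l x y)%:R * ((h x + h y) / 2).
  rewrite -!big_split; apply: ler_sum => x _; rewrite -!big_split.
  apply: ler_sum => y _ /=; rewrite compressE /uncutrel /cutrel.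
  case exy: (e x y); last by rewrite !mul0r !addr0.
  case: (eqVneq (l x) (l y)) => [lxy|lxy] /=; rewrite !mul1r !mul0r.
    rewrite addr0 /f -(l_a exy lxy); case: (a x); rewrite /= ?mulr1n ?mulr0n.
      by rewrite !mul0r addr0 mul0r addr0.
    have := psd_offdiag_le g_adm.1 x y ltr01; rewrite mul1r divr1 add0r !mul1r; lra.
  rewrite !add0r.
  (* The weight [th] falls on the density at [u], which is at most 1, so only the density at [v]
     remains in the charge. *)
  have main u v : ~~ a v -> 2 * re (g u v) <= h v.
    move=> av; apply: le_trans (psd_offdiag_le g_adm.1 u v th_gt0) _.
    rewrite /h av mul1r lerD2r -[X in _ <= X]mulr1.
    by rewrite ler_wpM2l ?admissible_diag_le1 // ltW.
  case: (boolP (a x)) => ax; last first.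
    have := main y x ax; rewrite (psd_conj_entry g_adm.1) re_conj.
    by have := h0 y; lra.
  case: (boolP (a y)) => ay; first by rewrite (a_l ax ay) eqxx in lxy.
  by have := main x y ay; have := h0 x; lra.
move: hop; rewrite (sum_rel_half f (uncut_sym e_sym l)).
rewrite (sum_rel_half h (cut_sym e_sym l)).
set T1 := \sum_x \sum_y (e x y)%:R * _; set T2 := \sum_x \sum_y _ => hop.
have -> : \sum_x (D%:R - mu) * re (compress a g x x) =
  \sum_x (D%:R - mu) * ((a x)%:R * r x).
  apply: eq_bigr => x _; rewrite compressE andbb.
  by case: (a x); rewrite ?mul1r ?mul0r.
rewrite [\sum_(x | ~~ a x) _]big_mkcond /=.
suff : \sum_x (D%:R - mu) * ((a x)%:R * r x) +
   \sum_x (if ~~ a x then (nc x - mu) * r x - nc x * (th + r x / th) else 0) =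
   \sum_x (D%:R - mu) * r x - \sum_x reldeg (uncutrel e l) x * f x - \sum_x nc x * h x by lra.
rewrite -!sumrB -big_split; apply: eq_bigr => x _ /=; rewrite (reldeg_uncut e_deg) /f /h.
by case: (a x) => /=; ring.
Qed.

End HoppingCost.

(** * Lower bound for the two-spin energy and its case of equality *)

Section Ferromagnetism.
Context {R : realType} {n : nat} (D : nat) (mu : R) (e : rel 'I_n).
Local Notation C := R[i].
Hypotheses (e_sym : symmetric e) (e_irr : irreflexive e)
  (e_deg : forall x, reldeg e x = D%:R :> R)
  (e_conn : forall f : 'I_n -> nat, (forall x y, e x y -> f x = f y) ->
     forall x y, f x = f y).
Hypotheses (D_gt0 : (0 < D)%N) (mu_gt0 : 0 < mu) (mu_le : mu <= 1 / 2).
Local Notation K := (ham (D%:R - mu) e).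
Variables (W : 'M[C]_n) (t : 'I_n -> R) (S : pred 'I_n).
Hypothesis W_diag : diagonalizes W t K.
Hypothesis t_S : forall k, S k -> - mu <= t k <= - (mu / 2).
Hypothesis W_S : forall l k, S k -> forall x,
  3 / 4 * reldeg (cutrel e l) x / n%:R <= sqn (\sum_y (cutrel e l x y)%:R * ctr W y k).
Variables (U th : R) (gu gd : 'M[C]_n).
Hypotheses (gu_adm : admissible gu) (gd_adm : admissible gd).
Hypotheses (th_gt0 : 0 < th) (th_lt : 4 * th < seg_const D mu S)
  (U_gt : mu + D%:R / th < U * th ^+ 2).
Local Notation ru x := (re (gu x x)).
Local Notation rd x := (re (gd x x)).

Definition hfz : R := re (\tr (K *m (gu + gd))) + U * \sum_x ru x * rd x.

(* Sites where both densities are below [th ^+ 2] become singleton blocks. *)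
Definition block (x : 'I_n) : nat :=
  if (th ^+ 2 <= ru x) && (rd x <= ru x) then 0
  else if th ^+ 2 <= rd x then 1 else x.+2.

(** The value is 0 on singleton blocks because there the cut edges alone pay for both spins. *)
Definition minority x : R :=
  match block x with 0%N => rd x | 1%N => ru x | _ => 0 end.

Local Notation nc x := (reldeg (cutrel e block) x : R).

Lemma minority_ge0 x : 0 <= minority x.
Proof.
rewrite /minority; case: (block x) => [|[|?]] //; apply: psd_diag_ge0.
  by case: gd_adm.
by case: gu_adm.
Qed.

Lemma reldeg_cut_le x : nc x <= D%:R.
Proof.
rewrite -(e_deg x) /reldeg; apply: ler_sum => y _.
by rewrite ler_nat /cutrel; case: (e x y); case: (_ != _).
Qed.

(** The labels [x.+2] are pairwise distinct and no site is its own neighbour, so every edge at such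
    a site is cut. *)
Lemma reldeg_cut_singleton x : (1 < block x)%N -> nc x = D%:R.
Proof.
move=> bx; have bxE y : (1 < block y)%N -> block y = y.+2.
  by rewrite /block; case: ifP => // _; case: ifP.
rewrite -(e_deg x); apply: eq_bigr => y _; rewrite /cutrel.
case: (boolP (e x y)) => //= exy; case: eqVneq => // bxy.
have := bxy; rewrite (bxE x bx) bxE -?bxy // => -[/val_inj xy].
by move: exy; rewrite xy e_irr.
Qed.

(** On a labelled site the majority density is at least [th ^ 2], so the repulsion on the minority
    outweighs [mu + D / th]. On a singleton both densities are at most [th ^ 2], and each spin loses
    at most [2 * th] per cut edge. *)
Lemma site_cost x :
  (if block x != 0%N then (nc x - mu) * ru x - nc x * (th + ru x / th) else 0) +
  (if block x != 1%N then (nc x - mu) * rd x - nc x * (th + rd x / th) else 0) +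
  U * (ru x * rd x)
  >= - (4 * th) * nc x + (U * th ^+ 2 - mu - D%:R / th) * minority x.
Proof.
have th0 := th_gt0; have mu0 := mu_gt0; have mu1 := mu_le.
have D1 : 1 <= D%:R :> R by rewrite ler1n.
have u0 : 0 <= ru x by apply: psd_diag_ge0; case: gu_adm.
have d0 : 0 <= rd x by apply: psd_diag_ge0; case: gd_adm.
have n0 := @reldeg_ge0 R n (cutrel e block) x; have nD := reldeg_cut_le x.
have th20 : 0 < th ^+ 2 by rewrite exprn_gt0.
have Dth : 0 <= D%:R / th by rewrite divr_ge0 // ltW.
have U0 : 0 <= U.
  rewrite -(pmulr_lge0 _ th20); apply: le_trans (ltW U_gt); lra.
have minor (a b : R) : th ^+ 2 <= a -> 0 <= b ->
  - (4 * th) * nc x + (U * th ^+ 2 - mu - D%:R / th) * b <=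
  (nc x - mu) * b - nc x * (th + b / th) + U * (a * b).
  move=> ha hb.
  have h1 : U * th ^+ 2 * b <= U * (a * b).
    by rewrite -mulrA ler_wpM2l // ler_wpM2r.
  have h2 : nc x * (b / th) <= D%:R * (b / th).
    by rewrite ler_wpM2r // divr_ge0 // ltW.
  have h3 : 0 <= nc x * b by rewrite mulr_ge0.
  have h4 : 0 <= nc x * th by rewrite mulr_ge0 // ltW.
  rewrite !mulrDr; lra.
rewrite /minority; have sing := @reldeg_cut_singleton x.
have bE : block x = if (th ^+ 2 <= ru x) && (rd x <= ru x) then 0%N
  else if th ^+ 2 <= rd x then 1%N else x.+2 by [].
move: sing; rewrite bE; case: ifP => [/andP[hu _] _ /=|h].
  by rewrite add0r; apply: minor.
case: ifP => [hd _ /=|h' /(_ isT) /=].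
  by rewrite addr0 [ru x * rd x]mulrC; apply: minor.
move: (reldeg _ _) => N NE.
have hd : rd x <= th ^+ 2 by apply: ltW; rewrite ltNge h'.
have hu : ru x <= th ^+ 2.
  move/negbT: h; rewrite negb_and -!ltNge => /orP[/ltW//|/ltW h].
  exact: le_trans h hd.
have bound (b : R) : 0 <= b -> b <= th ^+ 2 -> - (2 * th) * N <= (N - mu) * b - N * (th + b / th).
  move=> b0 bt; rewrite NE.
  have h1 : b / th <= th by rewrite ler_pdivrMr // -expr2.
  have h2 : D%:R * (b / th) <= D%:R * th by rewrite ler_wpM2l // ltW // ltr0n.
  have h3 : 0 <= (D%:R - mu) * b by apply: mulr_ge0 => //; lra.
  rewrite mulrDr; lra.
have := bound _ u0 hu; have := bound _ d0 hd.
have := mulr_ge0 U0 (mulr_ge0 u0 d0); lra.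
Qed.

(** The bathtub bound for [A] is applied to the merged matrix, and [segregation] compares the Fermi
    sea of [A] with that of [K]. *)
Lemma hfz_lower :
  \sum_(i | t i < 0) t i + (seg_const D mu S - 4 * th) * (\sum_x nc x)
    + (U * th ^+ 2 - mu - D%:R / th) * (\sum_x minority x) <= hfz.
Proof.
have [V [d hV]] := hermitian_diagonalizes
  (ham_hermitian (D%:R - mu) (uncut_sym e_sym block)).
pose au := [pred x | block x == 0%N]; pose ad := [pred x | block x == 1%N].
have adm : admissible (compress au gu + compress ad gd).
  apply: compress_admissible => // x.
  by rewrite /au /ad /=; case: (block x) => [|[]].
have hu : _ <= re (\tr (K *m gu)) :=
  @hopping_cost R n D mu e e_sym e_deg block au gu th
    (fun x y hx hy => etrans (eqP hx) (esym (eqP hy)))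
    (fun x y _ E => congr1 (fun k => k == 0%N) E) gu_adm th_gt0.
have hd : _ <= re (\tr (K *m gd)) :=
  @hopping_cost R n D mu e e_sym e_deg block ad gd th
    (fun x y hx hy => etrans (eqP hx) (esym (eqP hy)))
    (fun x y _ E => congr1 (fun k => k == 1%N) E) gd_adm th_gt0.
have seg := segregation e_sym e_deg D_gt0 mu_gt0 mu_le W_diag t_S (@W_S block) hV.
have := bathtub_le hV adm.
have := tr_diagonalizes hV adm.1 => /(congr1 (@complex.Re R)) /= <-.
rewrite mulmxDr mxtraceD reD => low.
have sites : \sum_x (- (4 * th) * nc x + (U * th ^+ 2 - mu - D%:R / th) * minority x) <=
  \sum_(x | ~~ au x) ((nc x - mu) * ru x - nc x * (th + ru x / th)) +
  \sum_(x | ~~ ad x) ((nc x - mu) * rd x - nc x * (th + rd x / th)) +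
  U * \sum_x ru x * rd x.
  rewrite [\sum_(x | ~~ au x) _]big_mkcond [\sum_(x | ~~ ad x) _]big_mkcond mulr_sumr.
  by rewrite -!big_split; apply: ler_sum => x _; exact: site_cost.
move: sites; rewrite big_split -!mulr_sumr /=.
rewrite /hfz mulmxDr mxtraceD reD; lra.
Qed.

Lemma hfz_ge : \sum_(i | t i < 0) t i <= hfz.
Proof.
apply: le_trans hfz_lower; rewrite -addrA lerDl addr_ge0 // mulr_ge0 //.
- by move: th_lt; lra.
- by apply: sumr_ge0 => x _; exact: reldeg_ge0.
- by move: U_gt; lra.
- by apply: sumr_ge0 => x _; exact: minority_ge0.
Qed.

(** Equality leaves no cut edge and no minority density. Connectedness then gives one label
    everywhere, one spin vanishes, and the other is settled by [fermi_unique]. *)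
Lemma hfz_eq : hfz = \sum_(i | t i < 0) t i -> (forall i, t i != 0) ->
  (gu = fermi W t /\ gd = 0) \/ (gu = 0 /\ gd = fermi W t).
Proof.
move=> E t0; have := hfz_lower; rewrite E -addrA gerDl => h.
have sc0 : 0 < seg_const D mu S - 4 * th by move: th_lt; lra.
have w0 : 0 < U * th ^+ 2 - mu - D%:R / th by move: U_gt; lra.
have nc0 : 0 <= \sum_x nc x by apply: sumr_ge0 => x _; exact: reldeg_ge0.
have mi0 : 0 <= \sum_x minority x by apply: sumr_ge0 => x _; exact: minority_ge0.
have p1 := mulr_ge0 (ltW sc0) nc0; have p2 := mulr_ge0 (ltW w0) mi0.
have /eqP : (seg_const D mu S - 4 * th) * (\sum_x nc x) = 0 by lra.
rewrite mulf_eq0 (gt_eqF sc0) /= psumr_eq0 => [|x _]; last exact: reldeg_ge0.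
move=> /allP nc_eq0.
have /eqP : (U * th ^+ 2 - mu - D%:R / th) * (\sum_x minority x) = 0 by lra.
rewrite mulf_eq0 (gt_eqF w0) /= psumr_eq0 => [|x _]; last exact: minority_ge0.
move=> /allP mi_eq0.
have block_const : forall x y, block x = block y.
  apply: e_conn => x y exy; apply/eqP/negPn/negP => bxy.
  have := nc_eq0 x (mem_index_enum _); rewrite /reldeg psumr_eq0 => [|z _]; last exact: ler0n.
  by move=> /allP /(_ y (mem_index_enum _)); rewrite /cutrel exy bxy /= oner_eq0.
have zero (g : 'M[C]_n) : psd g -> (forall x, re (g x x) = 0) -> g = 0.
  move=> hg g0; apply/matrixP => x y; rewrite mxE.
  by apply: (psd_zero_diag hg); rewrite (psd_diag hg) g0.
have mz x : minority x = 0 by apply/eqP; exact: mi_eq0 (mem_index_enum _).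
have nz x : nc x = 0 by apply/eqP; exact: nc_eq0 (mem_index_enum _).
case: (pickP 'I_n) => [x0 _|noI]; last first.
  by left; split; apply/matrixP => x; have := noI x.
move: E; rewrite /hfz.
case b0: (block x0) => [|[|b]].
- have -> : gd = 0.
    apply: zero => [|x]; first by case: gd_adm.
    by have := mz x; rewrite /minority (block_const x x0) b0.
  rewrite addr0 big1 ?mulr0 ?addr0; last by move=> x _; rewrite mxE /= mulr0.
  rewrite (tr_diagonalizes W_diag gu_adm.1) /= => E.
  by left; split => //; exact: (fermi_unique W_diag gu_adm t0 E).
- have -> : gu = 0.
    apply: zero => [|x]; first by case: gu_adm.
    by have := mz x; rewrite /minority (block_const x x0) b0.
  rewrite add0r big1 ?mulr0 ?addr0; last by move=> x _; rewrite mxE /= mul0r.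
  rewrite (tr_diagonalizes W_diag gd_adm.1) /= => E.
  by right; split => //; exact: (fermi_unique W_diag gd_adm t0 E).
(* A singleton label would make all [D > 0] edges at [x0] cut. *)
have := reldeg_cut_singleton (x := x0); rewrite b0 nz => /(_ isT) /esym /eqP.
by rewrite pnatr_eq0 -leqn0 leqNgt D_gt0.
Qed.

End Ferromagnetism.

(** * Plane waves on the torus *)
Section Torus.
Context {d L : nat} (L_gt2 : (2 < L)%N).

Definition step (b : bool) (a : 'I_L) : 'I_L := if b then ordS a else ord_pred a.
Definition site_shift (x : site d L) (i : 'I_d) (b : bool) : site d L :=
  [ffun j => if j == i then step b (x j) else x j].

Lemma stepK b : cancel (step b) (step (~~ b)).
Proof. by case: b => a /=; rewrite ?ordSK ?ord_predK. Qed.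

Lemma ordS_neq (a : 'I_L) : ordS a != a.
Proof.
apply/eqP => /(congr1 val) /=; have aL := ltn_ord a.
case: (ltnP a.+1 L) => h; first by rewrite modn_small //; lia.
have -> : a.+1 = L by lia.
by rewrite modnn; lia.
Qed.

(** For [L = 2] the forward and backward neighbours coincide; [L > 2] separates them, so a site has
    [2 * d] distinct neighbours. *)
Lemma ordS2_neq (a : 'I_L) : ordS (ordS a) != a.
Proof.
apply/eqP => /(congr1 val) /=; have aL := ltn_ord a.
rewrite -(addn1 (_ %% _)) modnDml addn1.
case: (ltnP a.+2 L) => h; first by rewrite modn_small //; lia.
have -> : a.+2 = (L + (a.+2 - L))%N by lia.
by rewrite modnDl modn_small; lia.
Qed.

Lemma step_neq b a : step b a != a.
Proof.
case: b; first exact: ordS_neq.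
by apply/eqP => h; have := ordS_neq a; rewrite -{1}h /= ord_predK eqxx.
Qed.

Lemma step_inj a : injective (step^~ a).
Proof.
have h : ordS a != ord_pred a.
  by apply/eqP => h; have := ordS2_neq a; rewrite h ord_predK eqxx.
by move=> [] [] //= /eqP; rewrite ?(negbTE h) // eq_sym (negbTE h).
Qed.

Lemma nbZP (a b : 'I_L) : reflect (exists c, b = step c a) (nbZ a b).
Proof.
apply: (iffP andP) => [[ab /orP[] /eqP h]|[c ->]].
- by exists true; apply: val_inj.
- exists false; apply: (can_inj (@ordSK L)); rewrite /= ord_predK; exact/esym/val_inj.
split; first by rewrite eq_sym step_neq.
by case: c => /=; rewrite ?eqxx //; apply/orP; right; apply/eqP;
  rewrite -[in LHS](ord_predK a).
Qed.

Lemma adj_shiftP (x y : site d L) : reflect (exists i b, y = site_shift x i b) (adj x y).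
Proof.
apply: (iffP existsP) => [[i /andP[/nbZP[b h] /forallP h']]|[i [b ->]]].
  exists i, b; apply/ffunP => j; rewrite ffunE; case: eqVneq => [->//|ji].
  by apply/esym/eqP; have := h' j; rewrite ji.
exists i; apply/andP; split; first by apply/nbZP; exists b; rewrite ffunE eqxx.
by apply/forallP => j; apply/implyP => /negbTE ji; rewrite ffunE ji.
Qed.

Lemma shift_inj x : injective (fun p : 'I_d * bool => site_shift x p.1 p.2).
Proof.
move=> [i b] [j c] /= h; have ij : i = j.
  apply/eqP/negPn/negP => ij; have := congr1 (fun f : site d L => f i) h.
  by rewrite !ffunE eqxx (negbTE ij) => /eqP; rewrite (negbTE (step_neq _ _)).
move: h; rewrite ij => /(congr1 (fun f : site d L => f j)).
by rewrite !ffunE eqxx => /step_inj ->.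
Qed.

Lemma shiftK x i b : site_shift (site_shift x i b) i (~~ b) = x.
Proof. by apply/ffunP => j; rewrite !ffunE; case: eqP => // _; rewrite stepK. Qed.

Lemma adj_sym (x y : site d L) : adj x y = adj y x.
Proof.
by apply/adj_shiftP/adj_shiftP => -[i [b ->]]; exists i, (~~ b); rewrite shiftK.
Qed.

Lemma adj_irr (x : site d L) : adj x x = false.
Proof.
case: (adj_shiftP x x) => // -[i [b h]]; have /eqP := congr1 (fun f : site d L => f i) h.
by rewrite ffunE eqxx eq_sym (negbTE (step_neq _ _)).
Qed.

Lemma sum_adj (V : pzRingType) (x : site d L) (F : site d L -> V) :
  \sum_y (adj x y)%:R * F y = \sum_i \sum_b F (site_shift x i b).
Proof.
rewrite pair_bigA /=.
transitivity (\sum_(y | y \in [set site_shift x p.1 p.2 | p : 'I_d * bool]) F y).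
  rewrite [RHS]big_mkcond; apply: eq_bigr => y _.
  have -> : (y \in [set site_shift x p.1 p.2 | p : 'I_d * bool]) = adj x y.
    apply/imsetP/adj_shiftP => [[[i b] _ ->]|[i [b ->]]]; first by exists i, b.
    by exists (i, b).
  by case: (adj x y); rewrite (mul1r, mul0r).
by rewrite big_imset //= => p q _ _; exact: shift_inj.
Qed.

(** Connectedness of the torus. Unit steps bring one coordinate to any value, and [hyb k] replaces
    the coordinates of [x] by those of [y] one after another. *)
Lemma shift_invariant (T : Type) (f : site d L -> T) :
  (forall x i, f (site_shift x i true) = f x) -> forall x y, f x = f y.
Proof.
move=> h; have L0 : (0 < L)%N by lia.
pose set_at (x : site d L) i (a : 'I_L) : site d L := [ffun j => if j == i then a else x j].
have set0 x i (a : 'I_L) : f (set_at x i a) = f (set_at x i (Ordinal L0)).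
  case: a => m mL; elim: m mL => [|m IH] mL.
    by congr (f (set_at x i _)); apply: val_inj.
  rewrite -(IH (ltnW mL)) -(h (set_at x i (Ordinal (ltnW mL))) i); congr f; apply/ffunP => j; rewrite !ffunE.
  by case: eqP => // _; apply: val_inj; rewrite /= modn_small.
have set_at_eq x i a : f (set_at x i a) = f x.
  rewrite set0 -(set0 x i (x i)); congr f.
  by apply/ffunP => j; rewrite ffunE; case: eqP => // ->.
move=> x y; pose hyb k : site d L := [ffun j : 'I_d => if (j < k)%N then y j else x j].
have hk k : (k <= d)%N -> f (hyb k) = f x.
  elim: k => [|k IH] kd; first by congr f; apply/ffunP => j; rewrite ffunE.
  rewrite -(IH (ltnW kd)) -(set_at_eq (hyb k) (Ordinal kd) (y (Ordinal kd))).
  congr f; apply/ffunP => j; rewrite !ffunE ltnS leq_eqVlt.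
  rewrite -(inj_eq val_inj) /=; case: eqP => [jk|//] /=.
  by congr (y _); apply: val_inj.
by rewrite -(hk d) //; congr f; apply/ffunP => j; rewrite ffunE ltn_ord.
Qed.

End Torus.

Import numFieldNormedType.Exports.

(** * Elementary trigonometry *)

Section Trigonometry.
Context {R : realType}.
Local Notation C := R[i].

Lemma sin_le_id (x : R) : 0 <= x -> sin x <= x.
Proof.
move=> x0.
have cs : {within `[0, x], continuous (@sin R)}%classic.
  exact: (continuous_subspaceT (@continuous_sin R)).
have [c _] := MVT_segment x0 (fun y _ => is_derive_sin y) cs.
rewrite sin0 !subr0 => ->; rewrite -[X in _ <= X]mul1r.
by rewrite ler_wpM2r // cos_le1.
Qed.

Lemma one_sub_cos (x : R) : 1 - cos x = 2 * sin (x / 2) ^+ 2.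
Proof.
have {1}-> : x = (x / 2) *+ 2 by rewrite -mulr_natr divfK // pnatr_eq0.
have := cos2Dsin2 (x / 2); rewrite cos_mulr2n [_ *+ 2]mulr2n; lra.
Qed.

(** This follows from [1 - cos x = 2 * sin (x / 2) ^ 2] and [sin (x / 2) <= x / 2]; the range of [x]
    keeps the sine nonnegative, so that squaring is monotone. *)
Lemma cos_ge_quadratic (x : R) : 0 <= x <= 2 * pi -> 1 - x ^+ 2 / 2 <= cos x.
Proof.
move=> /andP[x0 x1]; have := one_sub_cos x.
have h : sin (x / 2) ^+ 2 <= (x / 2) ^+ 2.
  rewrite ler_sqr ?nnegrE; last by lra.
    by apply: sin_le_id; lra.
  by apply: sin_ge0_pi; apply/andP; split; lra.
have -> : x ^+ 2 / 2 = 2 * (x / 2) ^+ 2 by field.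
lra.
Qed.

Definition cis (x : R) : C := cos x +i* sin x.

Lemma cisD x y : cis (x + y) = cis x * cis y.
Proof.
rewrite /cis cosD sinD; apply/eqP; rewrite eq_complex /=.
by rewrite eqxx addrC eqxx.
Qed.
Lemma cis0 : cis 0 = 1. Proof. by rewrite /cis cos0 sin0. Qed.
Lemma conj_cis x : conjc (cis x) = cis (- x).
Proof. by rewrite /cis cosN sinN. Qed.
Lemma sqn_cis x : sqn (cis x) = 1. Proof. exact: cos2Dsin2. Qed.
Lemma cis_natmul x n : cis x ^+ n = cis (n%:R * x).
Proof.
elim: n => [|n IH]; first by rewrite expr0 mul0r cis0.
by rewrite exprS IH -cisD -natr1 mulrDl mul1r addrC.
Qed.
Lemma cisNK x : cis (- x) * cis x = 1.
Proof. by rewrite -cisD addNr cis0. Qed.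

End Trigonometry.

(** * Characters of the torus and their orthogonality *)

Section Waves.
Context {R : realType} {d L : nat} (L_gt2 : (2 < L)%N).
Local Notation C := R[i].

(** Indexed by [nat] rather than ['I_L], because differences of momenta and the cutoff are angles
    too. *)
Definition ang (k : nat) : R := k%:R * (2 * pi / L%:R).

Let L0 : L%:R != 0 :> R. Proof. by rewrite pnatr_eq0; lia. Qed.

Lemma cis_angL k : cis (ang k) ^+ L = 1.
Proof.
rewrite /ang -cis_natmul -exprM mulnC exprM cis_natmul mulrC divfK //.
have -> : cis (2 * pi : R) = 1 by rewrite /cis mulr_natl -(add0r (_ *+ 2)) cosD2pi sinD2pi cos0 sin0.
by rewrite expr1n.
Qed.

Definition wave (k x : site d L) : C := \prod_i cis (ang (k i)) ^+ x i.

(** Wrapping around the cycle is harmless since [cis (ang k)] is an [L]-th root of unity. *)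
Lemma cis_step k b (a : 'I_L) :
  cis (ang k) ^+ step b a = cis (ang k) ^+ a * cis (if b then ang k else - ang k).
Proof.
have S (z : 'I_L) : cis (ang k) ^+ ordS z = cis (ang k) ^+ z * cis (ang k).
  by rewrite -exprSr; exact: expr_mod (cis_angL k).
case: b; first exact: S.
by rewrite -{2}(ord_predK a) S -mulrA -cisD subrr cis0 mulr1.
Qed.

Lemma wave_shift k x i b : wave k (site_shift x i b) =
  wave k x * cis (if b then ang (k i) else - ang (k i)).
Proof.
rewrite /wave (bigD1 i) //= [in RHS](bigD1 i) //= ffunE eqxx cis_step mulrAC; congr (_ * _ * _).
by apply: eq_bigr => j /negbTE ji; rewrite ffunE ji.
Qed.

Lemma sqn_wave k x : sqn (wave k x) = 1.
Proof.
rewrite /wave; apply: (big_ind (fun z => sqn z = 1)).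
- by rewrite /sqn /= expr1n expr0n addr0.
- by move=> y z hy hz; rewrite sqnM hy hz mulr1.
- by move=> i _; rewrite cis_natmul sqn_cis.
Qed.

Lemma sum_adj_wave k x : \sum_y (adj x y)%:R * wave k y =
  wave k x * (\sum_i 2 * cos (ang (k i)))%:C.
Proof.
rewrite sum_adj // rmorph_sum mulr_sumr; apply: eq_bigr => i _.
rewrite big_bool /= !wave_shift -mulrDr; congr (_ * _).
by rewrite /cis cosN sinN; apply/eqP; rewrite eq_complex /= subrr eqxx mulr2n mulrDl mul1r eqxx.
Qed.

(** Otherwise [cis (ang (k - j)) = 1] with [0 < k - j < L], but half of that angle lies strictly
    between 0 and [pi], where the sine is positive. *)
Lemma cis_ang_inj (j k : 'I_L) : cis (ang j) = cis (ang k) -> j = k.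
Proof.
wlog jk : j k / (j <= k)%N.
  by move=> h; case: (leqP j k) => jk E; [|symmetry]; apply: h; rewrite ?(ltnW jk).
move=> E; apply/val_inj/eqP; rewrite /= eqn_leq jk leqNgt; apply/negP => lt.
have : cis (ang (k - j)) = 1.
  rewrite /ang natrB // mulrBl cisD -/(ang k) -E -/(ang j) mulrC; exact: cisNK.
move=> /(congr1 (@complex.Re R)) /= h; have := one_sub_cos (ang (k - j)).
rewrite h subrr; suff : 0 < sin (ang (k - j) / 2) by nra.
have kL := ltn_ord k; have L00 : 0 < L%:R :> R by rewrite ltr0n; lia.
have p0 := pi_gt0 R.
have -> : ang (k - j) / 2 = (k - j)%:R / L%:R * pi by rewrite /ang; field.
apply: sin_gt0_pi; rewrite mulr_gt0 ?divr_gt0 ?ltr0n ?subn_gt0 //=.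
rewrite -[X in _ < X]mul1r ltr_pM2r // ltr_pdivrMr // mul1r ltr_nat.
by apply: leq_ltn_trans kL; rewrite leq_subr.
by lia.
Qed.

(** The sum factors into one geometric sum per coordinate, and that of a nontrivial [L]-th root of
    unity vanishes. *)
Lemma wave_orth k k' : \sum_x conjc (wave k x) * wave k' x = ((k == k') * L ^ d)%:R.
Proof.
pose q i := conjc (cis (ang (k i))) * cis (ang (k' i)).
transitivity (\prod_i \sum_(j < L) q i ^+ j).
  rewrite (bigA_distr_bigA (fun i (j : 'I_L) => q i ^+ j)); apply: eq_bigr => x _.
  rewrite /wave rmorph_prod -big_split; apply: eq_bigr => i _ /=.
  by rewrite rmorphXn -exprMn.
case: eqVneq => [kk|kk'].
  rewrite mul1n natrX (eq_bigr (fun=> L%:R)); first by rewrite prodr_const card_ord.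
  move=> i _; rewrite (eq_bigr (fun=> 1)) ?sumr_const ?card_ord // => j _.
  by rewrite /q -kk conj_cis cisNK expr1n.
have [i ki] : exists i, k i != k' i.
  apply/existsP; rewrite -negb_forall; apply: contra kk' => /forallP h.
  by apply/eqP/ffunP => i; apply/eqP/h.
rewrite (bigD1 i) //= [X in X * _](_ : _ = 0) ?mul0r //.
have : (q i - 1) * (\sum_(j < L) q i ^+ j) = 0.
  by rewrite -subrX1 /q exprMn -rmorphXn /= !cis_angL rmorph1 mul1r subrr.
move=> /eqP; rewrite mulf_eq0 => /orP[|/eqP//]; rewrite subr_eq0 => /eqP q1.
case/eqP: ki; apply: cis_ang_inj.
by rewrite -[LHS]mulr1 -q1 /q conj_cis mulrA (mulrC (cis _)) cisNK mul1r.
Qed.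

End Waves.

(** * Fourier diagonalization of the lattice Laplacian and its low modes *)

Section Lattice.
Context {R : realType} {d L : nat} (L_gt2 : (2 < L)%N) (d_gt0 : (0 < d)%N).
Local Notation C := R[i].
Local Notation n := (nsites d L).
Local Notation ev := (@enum_val (site d L) predT).

Definition nbr : rel 'I_n := fun i j => adj (ev i) (ev j).

Lemma sum_sites (V : nmodType) (F : site d L -> V) : \sum_(i < n) F (ev i) = \sum_x F x.
Proof. by rewrite -big_enum_val. Qed.

Lemma nbr_sym : symmetric nbr. Proof. by move=> i j; exact: adj_sym. Qed.
Lemma nbr_irr : irreflexive nbr. Proof. by move=> i; exact: adj_irr. Qed.

Lemma nbr_deg x : reldeg nbr x = (2 * d)%:R :> R.
Proof.
rewrite /reldeg /nbr (sum_sites (fun y => (adj (ev x) y)%:R)).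
have := sum_adj L_gt2 (ev x) (fun=> 1 : R).
under eq_bigr do rewrite mulr1; move=> ->.
rewrite (eq_bigr (fun=> 2)); last by move=> i _; rewrite big_bool.
by rewrite sumr_const card_ord natrM mulr_natr.
Qed.

Lemma nbr_conn (f : 'I_n -> nat) : (forall x y, nbr x y -> f x = f y) ->
  forall x y, f x = f y.
Proof.
move=> h x y; rewrite -(enum_valK x) -(enum_valK y).
apply: (shift_invariant L_gt2 (f := fun x => f (enum_rank x))) => z i.
symmetry; apply: h; rewrite /nbr !enum_rankK.
by apply/(adj_shiftP L_gt2); exists i, true.
Qed.

Lemma Kmu_ham (mu : R) : Kmu d L mu = ham ((2 * d)%:R - mu) nbr.
Proof.
apply/matrixP => i j; rewrite /Kmu /lap /ham !mxE /nbr rmorphB rmorph_nat.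
by case: (i == j); rewrite ?mulr1n ?mulr0n; ring.
Qed.

Lemma nsitesE : n = (L ^ d)%N.
Proof. by rewrite /nsites card_ffun !card_ord. Qed.

Lemma nsites_gt0 : 0 < n%:R :> R.
Proof. by rewrite nsitesE ltr0n expn_gt0; apply/orP; left; lia. Qed.

(** Rows are conjugated, so the columns of [ctr fourier] are the normalized plane waves. Momenta
    share the enumeration of the sites. *)
Definition fourier : 'M[C]_n :=
  \matrix_(k, x) (conjc (wave (ev k) (ev x)) * ((Num.sqrt n%:R)^-1)%:C).

Definition dispersion (mu : R) (k : 'I_n) : R :=
  (2 * d)%:R - mu - \sum_i 2 * cos (ang (L := L) (ev k i)).

Lemma ctr_fourierE x k : ctr fourier x k = ((Num.sqrt n%:R)^-1)%:C * wave (ev k) (ev x).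
Proof.
have E (z : C) (r : R) : conjc (conjc z * r%:C) = r%:C * z.
  by case: z => a b; apply/eqP; rewrite eq_complex /=; apply/andP; split; apply/eqP; ring.
by rewrite ctrE mxE E.
Qed.

Lemma fourier_diagonalizes mu :
  diagonalizes fourier (dispersion mu) (ham ((2 * d)%:R - mu) nbr).
Proof.
have s0 : Num.sqrt n%:R != 0 :> R by rewrite gt_eqF // sqrtr_gt0 nsites_gt0.
have WWc : fourier *m ctr fourier = 1%:M.
  apply/matrixP => k k'; rewrite mxE [RHS]mxE.
  transitivity ((n%:R^-1)%:C * \sum_x conjc (wave (R := R) (ev k) x) * wave (ev k') x).
    rewrite -sum_sites mulr_sumr; apply: eq_bigr => x _.
    have -> : (n%:R^-1)%:C = ((Num.sqrt n%:R)^-1)%:C * ((Num.sqrt n%:R)^-1)%:C :> C.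
      by rewrite -rmorphM -invfM -expr2 sqr_sqrtr // ler0n.
    by rewrite ctr_fourierE mxE; ring.
  rewrite wave_orth // (inj_eq enum_val_inj) natrM -nsitesE.
  case: (k == k'); last by rewrite mul0r mulr0.
  rewrite mul1r -(rmorph_nat (real_complex R) n) -rmorphM mulVf ?rmorph1 //.
  by rewrite gt_eqF // nsites_gt0.
split=> //; set K := ham _ _.
have KW : K *m ctr fourier = ctr fourier *m rdiag (dispersion mu).
  apply/matrixP => x k; rewrite mul_rdiag /K /ham mulmxBl mul_scalar_mx.
  have -> : forall a (M N : 'M[C]_n), (a *: M - N) x k = a * M x k - N x k.
    by move=> a M N; rewrite !mxE.
  rewrite !ctr_fourierE mxE.
  have -> : \sum_j relmx (R := R) nbr x j * ctr fourier j k =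
      ((Num.sqrt n%:R)^-1)%:C * \sum_y (adj (ev x) y)%:R * wave (ev k) y.
    rewrite -sum_sites mulr_sumr; apply: eq_bigr => y _.
    by rewrite ctr_fourierE mxE mulrCA.
  by rewrite sum_adj_wave // /dispersion rmorphB; ring.
by rewrite -KW -mulmxA (mulmx1C WWc) mulmx1.
Qed.

Section LowModes.
Variables (mu s : R) (m : nat).
Hypotheses (mu_gt0 : 0 < mu) (mu_le : mu <= 1 / 2).
Hypotheses (s_ge0 : 0 <= s) (s2 : s ^+ 2 = mu / (2 * d%:R)) (ang_m : ang (L := L) m <= s).

(** A one-sided cube: momenta near [2 * pi], that is small negative ones, are left out, so angles
    can be compared directly. *)
Definition low (k : 'I_n) : bool := [forall i, (ev k i <= m)%N].

Lemma low_cos k i : low k -> 1 - mu / (4 * d%:R) <= cos (ang (L := L) (ev k i)).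
Proof.
move=> /forallP /(_ i) km.
have d1 : 1 <= d%:R :> R by rewrite ler1n.
have L0 : 0 < L%:R :> R by rewrite ltr0n; lia.
have p0 := pi_gt0 R.
have q0 : 0 <= 2 * pi / L%:R :> R by rewrite divr_ge0 ?ltW // mulr_gt0.
have a0 : 0 <= ang (R := R) (L := L) (ev k i) by rewrite mulr_ge0 // ler0n.
have ale : ang (R := R) (L := L) (ev k i) <= s.
  by apply: le_trans ang_m; rewrite ler_wpM2r // ler_nat.
have a2 : ang (R := R) (L := L) (ev k i) <= 2 * pi.
  have -> : ang (R := R) (L := L) (ev k i) = 2 * pi * ((ev k i)%:R / L%:R) by rewrite /ang; ring.
  rewrite ler_piMr //; first by rewrite mulr_ge0 // ltW.
  by rewrite ler_pdivrMr // mul1r ler_nat ltnW.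
apply: le_trans (cos_ge_quadratic _); last by rewrite a0.
have -> : mu / (4 * d%:R) = s ^+ 2 / 2 by rewrite s2; field; rewrite gt_eqF //; lra.
by rewrite lerD2l lerN2 ler_pM2r ?invr_gt0 // ler_sqr ?nnegrE.
Qed.

(** Each of the [d] directions adds at most [s ^ 2 = mu / (2 * d)] to the kinetic energy, hence at
    most [mu / 2] altogether. *)
Lemma low_dispersion k : low k -> - mu <= dispersion mu k <= - (mu / 2).
Proof.
move=> lk; have d1 : 1 <= d%:R :> R by rewrite ler1n.
have -> : dispersion mu k = \sum_(i < d) (2 - 2 * cos (ang (L := L) (ev k i))) - mu.
  rewrite sumrB sumr_const card_ord /dispersion natrM mulr_natr; lra.
apply/andP; split.
  rewrite -[X in X <= _]add0r lerD2r; apply: sumr_ge0 => i _.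
  by have := cos_le1 (ang (R := R) (L := L) (ev k i)); lra.
suff : \sum_(i < d) (2 - 2 * cos (ang (L := L) (ev k i))) <= mu / 2 by lra.
have -> : mu / 2 = \sum_(i < d) (mu / (2 * d%:R)).
  by rewrite sumr_const card_ord -mulr_natr; field; rewrite gt_eqF //; lra.
apply: ler_sum => i _; have := low_cos i lk.
have -> : mu / (2 * d%:R) = 2 * (mu / (4 * d%:R)) by field; rewrite gt_eqF //; lra.
lra.
Qed.

(** Relative to the phase at [x], each neighbour contributes a number of real part at least
    [1 - mu / (4 * d) >= 7 / 8], so the contributions add up. *)
Lemma low_local (l : 'I_n -> nat) k : low k -> forall x,
  3 / 4 * reldeg (cutrel nbr l) x / n%:R <=
  sqn (\sum_y (cutrel nbr l x y)%:R * ctr fourier y k).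
Proof.
move=> lk x; have n0 := nsites_gt0; have d1 : 1 <= d%:R :> R by rewrite ler1n.
set c := cutrel nbr l.
pose z : C := \sum_y (c x y)%:R * (conjc (wave (ev k) (ev x)) * wave (ev k) (ev y)).
have -> : sqn (\sum_y (c x y)%:R * ctr fourier y k) = sqn z / n%:R.
  have -> : z = conjc (wave (ev k) (ev x)) * (Num.sqrt n%:R)%:C *
     (\sum_y (c x y)%:R * ctr fourier y k).
    rewrite mulr_sumr; apply: eq_bigr => y _; rewrite ctr_fourierE.
    have h : (Num.sqrt n%:R)%:C * ((Num.sqrt n%:R)^-1)%:C = 1 :> C.
      by rewrite -rmorphM divff ?rmorph1 // gt_eqF // sqrtr_gt0.
    by rewrite -[X in X = _]mulr1 -h; ring.
  rewrite !sqnM sqn_conj sqn_wave mul1r sqnC sqr_sqrtr ?ler0n //.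
  by rewrite mulrC mulKf // gt_eqF.
rewrite ler_pM2r ?invr_gt0 //.
have rez : 7 / 8 * reldeg c x <= re z.
  rewrite /z re_sum mulr_sumr; apply: ler_sum => y _.
  case cxy: (c x y); last by rewrite mulr0 mul0r.
  rewrite mulr1 mul1r; move: cxy => /andP[/(adj_shiftP L_gt2) [i [b ->]] _].
  rewrite wave_shift // mulrA mul_conjc_sqn sqn_wave mul1r.
  have -> : re (cis (if b then ang (L := L) (ev k i) else - ang (L := L) (ev k i))) =
     cos (ang (L := L) (ev k i)) :> R by case: b => //=; rewrite cosN.
  apply: le_trans (low_cos i lk).
  have : mu / (4 * d%:R) <= mu / 4.
    rewrite ler_pM2l // lef_pV2 ?posrE //; lra.
  by move: mu_le; lra.
have N0 : 0 <= reldeg c x :> R := reldeg_ge0 _ _.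
have : re z ^+ 2 <= sqn z by rewrite /sqn lerDl sqr_ge0.
apply: le_trans.
(* The degree is an integer, hence at most its square, and [(7 / 8) ^ 2 >= 3 / 4]. *)
have [c0|c0] := eqVneq (reldeg c x : R) 0; first by rewrite c0 mulr0 sqr_ge0.
have c1 : 1 <= reldeg c x :> R.
  by move: c0; rewrite /reldeg -natr_sum pnatr_eq0 ler1n -lt0n.
have : (7 / 8 * reldeg c x) ^+ 2 <= re z ^+ 2.
  by rewrite ler_sqr ?nnegrE //; lra.
apply: le_trans; nra.
Qed.

Lemma low_count : (m < L)%N -> \sum_(k | low k) 1 = (m.+1 ^ d)%:R :> R.
Proof.
move=> mL; rewrite big_mkcond.
rewrite (sum_sites (fun x : site d L => if [forall i, (x i <= m)%N] then 1 else 0 : R)).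
transitivity (\sum_(x : site d L) \prod_i (x i <= m)%N%:R : R).
  apply: eq_bigr => x _; case: ifP => [/forallP h|/negbT].
    by rewrite big1 // => i _; rewrite h.
  by rewrite negb_forall => /existsP[i /negbTE h]; rewrite (bigD1 i) //= h mul0r.
rewrite -(bigA_distr_bigA (fun (i : 'I_d) (j : 'I_L) => (j <= m)%N%:R)).
rewrite prodr_const card_ord natrX; congr (_ ^+ _).
rewrite -natr_sum; congr (_%:R).
rewrite -(big_mkord predT (fun j => (j <= m)%N : nat)) (big_cat_nat (n := m.+1)) //=.
rewrite [X in (_ + X)%N]big_nat_cond [X in (_ + X)%N]big1 ?addn0; last first.
  by move=> j /andP[/andP[h _] _]; rewrite leqNgt h.
rewrite big_nat_cond (eq_bigr (fun=> 1%N)); last first.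
  by move=> j /andP[/andP[_ h] _]; rewrite -ltnS h.
by rewrite -big_nat_cond sum_nat_const_nat subn0 muln1.
Qed.

End LowModes.
End Lattice.

(** * The constants *)
Section GammaBound.
Context {R : realType}.

(** [exp (- 1 / 6) >= 5 / 6] gives [exp (1 / 6) <= 6 / 5], and [(6 / 5) ^ 6 < 3]. *)
Lemma expR1_le3 : expR 1 <= 3 :> R.
Proof.
have h : expR (6^-1) <= 6 / 5 :> R.
  have := expR_ge1Dx (- 6^-1 : R); rewrite expRN => h.
  move: h; rewrite -[X in _ <= X]mul1r ler_pdivlMr ?expR_gt0 //; lra.
have -> : expR 1 = expR (6^-1) ^+ 6 :> R by rewrite -expRM_natl mulfV // pnatr_eq0.
apply: (@le_trans _ _ ((6 / 5) ^+ 6)); last by lra.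
by rewrite lerXn2r // nnegrE ?expR_ge0 //; lra.
Qed.

Definition gamma_integrand (x t : R) : R := t `^ (x - 1) * expR (- t).

Lemma gamma_integrand_ge0 x t : 0 <= gamma_integrand x t.
Proof. by rewrite mulr_ge0 ?powR_ge0 ?expR_ge0. Qed.

Lemma measurable_gamma_integrand x : measurable_fun setT (gamma_integrand x).
Proof.
apply: measurable_funM; first exact: measurable_powR.
by apply: measurableT_comp => //; exact: measurable_funN.
Qed.

(* The derivative of [- exp (- sqrt t)] dominates the integrand up to a constant. *)
Definition gamma_majorant (t : R) : R := expR (- t `^ 2^-1) * (2^-1 * t `^ (2^-1 - 1)).

Lemma is_derive_majorant (t : R) : 0 < t ->
  is_derive t 1 (fun t => - expR (- t `^ 2^-1)) (gamma_majorant t).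
Proof.
move=> t0; have h := @is_derive1_powR R 2^-1 t t0.
rewrite /gamma_majorant; apply: is_derive_eq.
by rewrite mulrN opprK.
Qed.

Lemma derivable_majorant (t : R) : 0 < t -> derivable gamma_majorant t 1.
Proof.
move=> t0; have h := @is_derive1_powR R 2^-1 t t0.
have h' := @is_derive1_powR R (2^-1 - 1) t t0.
by apply: ex_derive.
Qed.

Lemma integral_majorant_le1 (a b : R) : 0 < a -> a < b ->
  (\int[lebesgue_measure]_(t in `[a, b]) (gamma_majorant t)%:E <= 1)%E.
Proof.
move=> a0 ab.
have pos t : t \in `[a, b] -> 0 < t by rewrite in_itv /= => /andP[/(lt_le_trans a0)].
have cg : {within `[a, b], continuous gamma_majorant}%classic.
  by apply: derivable_within_continuous => t /pos; exact: derivable_majorant.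
pose F t : R := - expR (- t `^ 2^-1).
have cF t : 0 < t -> {for t, continuous F}.
  move=> t0; apply/differentiable_continuous/derivable1_diffP.
  by have h := is_derive_majorant t0; exact: ex_derive.
rewrite (@continuous_FTC2 R gamma_majorant F a b ab cg).
- rewrite -EFinB lee_fin /F opprK.
  have : expR (- a `^ 2^-1) <= 1 :> R by rewrite -expR0 ler_expR oppr_le0 powR_ge0.
  by have h := expR_ge0 (- b `^ 2^-1 : R) => h1; rewrite addrC lerBlDr (le_trans h1) // lerDl.
- split.
  + move=> t; rewrite in_itv /= => /andP[/(lt_trans a0) t0 _].
    by have h := is_derive_majorant t0; exact: ex_derive.
  + by apply: cvg_at_right_filter; exact: cF.
  + by apply: cvg_at_left_filter; apply: cF; exact: lt_trans ab.
- move=> t; rewrite in_itv /= => /andP[/(lt_trans a0) t0 _].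
  by have h := is_derive_majorant t0; rewrite derive1E; exact: derive_val.
Qed.

(** After splitting off [t ^ (- 1 / 2)], the remaining power is at most
    [(1 + t) ^ n <= (2 * n) ^ n * exp (t / 2)], and [sqrt t <= (t + 1) / 2] turns [exp (- t / 2)]
    into [exp (- sqrt t)]. *)
Lemma gamma_integrand_le (n : nat) (x t : R) :
  (0 < n)%N -> 2^-1 <= x -> x <= n%:R -> 0 < t ->
  gamma_integrand x t <= 2 * (2 * n%:R) ^+ n * expR 2^-1 * gamma_majorant t.
Proof.
move=> n0 x1 x2 t0; have n1 : 1 <= n%:R :> R by rewrite ler1n.
rewrite /gamma_integrand /gamma_majorant; set u := t `^ 2^-1.
have u2 : u ^+ 2 = t by rewrite /u powR12_sqrt ?sqr_sqrtr // ltW.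
have -> : t `^ (x - 1) = t `^ (x - 2^-1) * t `^ (2^-1 - 1).
  by rewrite -powRD; [congr (_ `^ _); ring|rewrite (gt_eqF t0) ?implybT].
have h1 : t `^ (x - 2^-1) <= (2 * n%:R) ^+ n * expR (t / 2).
  apply: (@le_trans _ _ ((1 + t) ^+ n)).
    apply: (@le_trans _ _ ((1 + t) `^ (x - 2^-1))).
      by apply: ge0_ler_powR; rewrite ?nnegrE //; lra.
    by rewrite -powR_mulrn ?ler_powR //; lra.
  have -> : expR (t / 2) = expR (t / (2 * n%:R)) ^+ n.
    by rewrite -expRM_natl; congr expR; field; rewrite gt_eqF //; lra.
  have b0 : 1 + t <= 2 * n%:R * expR (t / (2 * n%:R)).
    apply: (@le_trans _ _ (2 * n%:R * (1 + t / (2 * n%:R)))).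
      have -> : 2 * n%:R * (1 + t / (2 * n%:R)) = 2 * n%:R + t.
        by field; rewrite gt_eqF //; lra.
      by lra.
    by rewrite ler_wpM2l ?expR_ge1Dx //; lra.
  rewrite -exprMn lerXn2r // nnegrE; lra.
have h2 : expR (t / 2) * expR (- t) <= expR 2^-1 * expR (- u).
  rewrite -!expRD ler_expR; have := sqr_ge0 (u - 1); nra.
have p0 := powR_ge0 t (2^-1 - 1); set w := t `^ (2^-1 - 1) in p0 *.
have -> : 2 * (2 * n%:R) ^+ n * expR 2^-1 * (expR (- u) * (2^-1 * w)) =
  (2 * n%:R) ^+ n * (expR 2^-1 * expR (- u)) * w by field.
rewrite mulrAC ler_wpM2r //.
apply: (@le_trans _ _ ((2 * n%:R) ^+ n * (expR (t / 2) * expR (- t)))).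
  by rewrite mulrA ler_wpM2r ?expR_ge0.
by rewrite ler_wpM2l // exprn_ge0 //; lra.
Qed.

(** [Gamma] is the [fine] part of an extended integral, which is 0 when the integral is infinite, so
    a lower bound for it requires finiteness. The half line is exhausted by compact intervals on
    which the majorant has integral at most 1. *)
Lemma integral_gamma_lty (x : R) : 2^-1 <= x ->
  (\int[lebesgue_measure]_(t in `]0%R, +oo[) (gamma_integrand x t)%:E < +oo)%E.
Proof.
move=> x1; pose n := (Num.truncn x).+1.
have xn : x <= n%:R by apply/ltW/truncnS_gt.
pose M : R := 2 * (2 * n%:R) ^+ n * expR 2^-1.
have M0 : 0 <= M by rewrite /M mulr_ge0 ?expR_ge0 // mulr_ge0 // exprn_ge0 // mulr_ge0.
pose D (k : nat) : set R := `[(k.+2%:R)^-1, k.+2%:R]%classic.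
have DE : `]0%R, +oo[%classic = (\bigcup_k D k)%classic.
  apply/seteqP; split => [t|t [k _]] /=.
    (* An index beyond [t + t^-1] bounds both [t] and its inverse. *)
    rewrite !in_itv /= andbT => t0; exists (Num.truncn (t + t^-1)) => //; rewrite /D /= in_itv /=.
    have h := truncnS_gt (t + t^-1); have ti : 0 < t^-1 by rewrite invr_gt0.
    have h2 : t + t^-1 <= (Num.truncn (t + t^-1)).+2%:R.
      by apply/ltW/(lt_le_trans h); rewrite ler_nat.
    apply/andP; split; last by lra.
    rewrite -[t]invrK lef_pV2 ?posrE ?ltr0n ?invrK //; lra.
  by rewrite /D /= !in_itv /= andbT => /andP[h _]; apply: lt_le_trans h; rewrite invr_gt0 ltr0n.
have mD k : measurable (D k) by exact: measurable_itv.
have nD : nondecreasing_seq D.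
  move=> i j ij; rewrite subsetEset => t; rewrite /D /= !in_itv /= => /andP[h1 h2].
  apply/andP; split; last by apply: (le_trans h2); rewrite ler_nat !ltnS.
  by apply: le_trans h1; rewrite lef_pV2 ?posrE ?ltr0n // ler_nat !ltnS.
have mf A : measurable_fun A (fun t => (gamma_integrand x t)%:E).
  by apply/measurable_EFinP; apply: measurable_funTS; exact: measurable_gamma_integrand.
have f0 k t : D k t -> (0 <= (gamma_integrand x t)%:E)%E.
  by move=> _; rewrite lee_fin gamma_integrand_ge0.
have cv := @ge0_nondecreasing_set_cvg_integral _ (measurableTypeR R) R D
  (fun t => (gamma_integrand x t)%:E) lebesgue_measure nD mD (fun k => mf (D k)) f0.
rewrite DE -(cvg_lim _ cv) //.
apply: (@le_lt_trans _ _ M%:E); last exact: ltry.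
apply: lime_le; first by apply/cvg_ex; eexists; exact: cv.
near=> k; have k2 : 1 < k.+2%:R :> R by rewrite ltr1n.
have kk : (k.+2%:R)^-1 < k.+2%:R :> R.
  by apply: (lt_trans _ k2); rewrite invf_lt1 // ltr0n.
have mg : measurable_fun (D k) (fun t => (gamma_majorant t)%:E).
  apply/measurable_EFinP; apply: measurable_funTS; apply: measurable_funM.
    apply: measurableT_comp => //; apply: measurable_funN; exact: measurable_powR.
  by apply: measurable_funM => //; exact: measurable_powR.
have g0 t : (0 <= (gamma_majorant t)%:E)%E.
  by rewrite lee_fin mulr_ge0 ?expR_ge0 // mulr_ge0 ?powR_ge0.
apply: (@le_trans _ _ (\int[lebesgue_measure]_(t in D k) (M%:E * (gamma_majorant t)%:E))%E).
  apply: ge0_le_integral => //.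
  - exact: mD.
  - by move=> t _; rewrite lee_fin gamma_integrand_ge0.
  - exact: mf.
  - by apply: emeasurable_funM.
  - move=> t; rewrite /D /= in_itv /= => /andP[h _].
    rewrite -EFinM lee_fin gamma_integrand_le //.
    by apply: lt_le_trans h; rewrite invr_gt0 ltr0n.
rewrite ge0_integralZl_EFin //; last exact: mD.
apply: (@le_trans _ _ (M%:E * 1)%E); last by rewrite mule1.
apply: lee_wpmul2l; first by rewrite lee_fin.
by apply: integral_majorant_le1 => //; rewrite invr_gt0 ltr0n.
Unshelve. all: by end_near.
Qed.

(** In logarithms the claim is [(x - 1) * (ln x - ln t) <= x - t]. For [x > 1] it follows from
    [ln (x / t) <= (x - t) / t] and [x - 1 <= t]; for [x <= 1] the left side is not positive. *)
Lemma gamma_integrand_ge (x t : R) : 2^-1 <= x -> x - 2^-1 < t <= x ->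
  x `^ (x - 1) * expR (- x) <= gamma_integrand x t.
Proof.
move=> x1 /andP[t1 t2]; have t0 : 0 < t by lra.
have x0 : 0 < x by lra.
rewrite /gamma_integrand /powR !gt_eqF // -!expRD ler_expR.
have q0 : 0 <= (x - t) / t by rewrite divr_ge0; lra.
have h : ln x - ln t <= (x - t) / t.
  rewrite -ln_div ?posrE //.
  have -> : x / t = 1 + (x - t) / t by field; rewrite gt_eqF.
  by apply: le_ln1Dx; lra.
have h0 : ln t <= ln x by rewrite ler_ln ?posrE.
suff : (x - 1) * (ln x - ln t) <= x - t by lra.
case: (leP x 1) => x2.
  apply: (@le_trans _ _ 0); last by lra.
  by rewrite mulr_le0_ge0 //; lra.
apply: (@le_trans _ _ (t * ((x - t) / t))); last by rewrite mulrC divfK // gt_eqF.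
by apply: ler_pM => //; lra.
Qed.

(** A crude Stirling bound, from an interval of length [1 / 2] ending at [x] on which the integrand
    is at least its value at [x]. *)
Lemma Gamma_ge (x : R) : 2^-1 <= x -> x `^ (x - 1) * expR (- x) / 2 <= Gamma x.
Proof.
move=> x1; pose f t := (gamma_integrand x t)%:E.
have mf A : measurable_fun A f.
  by apply/measurable_EFinP; apply: measurable_funTS; exact: measurable_gamma_integrand.
have f0 t : (0 <= f t)%E by rewrite lee_fin gamma_integrand_ge0.
set c := x `^ (x - 1) * expR (- x).
have c0 : 0 <= c by rewrite mulr_ge0 ?powR_ge0 ?expR_ge0.
have -> : c / 2 = fine (c / 2)%:E by [].
have fin : (\int[lebesgue_measure]_(t in `]0%R, +oo[) f t)%E \is a fin_num.
  by rewrite ge0_fin_numE ?integral_gamma_lty // integral_ge0.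
rewrite /Gamma /Rintegral; apply: fine_le => //.
pose I : set R := `]x - 2^-1, x]%classic.
have mI : measurable I by exact: measurable_itv.
apply: (@le_trans _ _ (\int[lebesgue_measure]_(t in I) f t)%E).
  apply: (@le_trans _ _ (\int[lebesgue_measure]_(t in I) cst c%:E t)%E).
    rewrite integral_cst //= /I lebesgue_measure_itv /= lte_fin ifT; last by lra.
    rewrite -EFinB -EFinM lee_fin; lra.
  apply: ge0_le_integral; first exact: mI.
  - by move=> t _; rewrite lee_fin.
  - exact: measurable_cst.
  - exact: mf.
  - by move=> t; rewrite /I /= in_itv /= => h; rewrite lee_fin gamma_integrand_ge.
apply: ge0_subset_integral; [exact: mI|exact: measurable_itv|exact: mf| |].
  by move=> t _; exact: f0.
move=> t; rewrite /I /= !in_itv /= andbT => /andP[h _]; lra.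
Qed.

End GammaBound.

(** * The threshold [theta] against [seg_const] and [Ustar] *)

Section Constants.
Context {R : realType} (d : nat) (mu : R).
Hypotheses (d_gt0 : (0 < d)%N) (mu_gt0 : 0 < mu) (mu_le : mu <= 1 / 2).

Lemma pi_le4 : pi <= 4 :> R.
Proof. by have /andP[_ h] := (pihalf_02_cos_pihalf R).1; lra. Qed.

(** The side of the momentum cube, chosen with [d * side ^ 2 = mu / 2]. *)
Definition side : R := Num.sqrt (mu / (2 * d%:R)).
(** The fraction of all momenta lying in [[0, side] ^ d] in the limit of large [L]. *)
Definition low_density : R := (side / (2 * pi)) ^+ d.

Let d1 : 1 <= d%:R :> R. Proof. by rewrite ler1n. Qed.

Lemma side_gt0 : 0 < side.
Proof. by rewrite sqrtr_gt0 divr_gt0 // mulr_gt0 // ltr0n. Qed.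

Lemma side2 : side ^+ 2 = mu / (2 * d%:R).
Proof. by rewrite sqr_sqrtr // divr_ge0 ?ltW // mulr_gt0 // ltr0n. Qed.

Lemma side_le : side <= 1 / 2.
Proof.
rewrite -(ler_pXn2r (n := 2)) ?nnegrE ?(ltW side_gt0) //.
have h1 := d1; have h2 := mu_le.
by rewrite side2 ler_pdivrMr ?mulr_gt0 ?ltr0n //; lra.
Qed.

Lemma low_density_gt0 : 0 < low_density.
Proof. by rewrite exprn_gt0 // divr_gt0 ?side_gt0 // mulr_gt0 // pi_gt0. Qed.

Lemma Gamma_half_gt0 : 0 < Gamma (d%:R / 2 : R).
Proof.
apply: lt_le_trans (Gamma_ge _); last by move: d1; lra.
by rewrite divr_gt0 // mulr_gt0 ?expR_gt0 ?powR_gt0 ?divr_gt0 ?ltr0n.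
Qed.

Lemma alphastar_gt0 : 0 < alphastar d mu.
Proof.
have d0 : 0 < d%:R :> R by rewrite ltr0n.
have p0 := pi_gt0 R.
rewrite /alphastar /sphere_area !(divr_gt0, mulr_gt0, exprn_gt0, powR_gt0, Gamma_half_gt0) //.
Qed.

(** Compares the ball behind [alphastar] with the cube; the factor 5 per dimension comes from
    [pi * e <= 12 <= 25 / 2]. *)
Lemma alphastar_le :
  alphastar d mu <= mu * 5 ^+ d * low_density / (1024 * d%:R ^+ 4).
Proof.
have d0 : 0 < d%:R :> R by rewrite ltr0n.
have p0 := pi_gt0 R; have s0 := side_gt0; have G0 := Gamma_half_gt0.
set x : R := d%:R / 2.
have x0 : 0 < x by rewrite divr_gt0.
have Gx : x `^ (x - 1) * expR (- x) / 2 <= Gamma x.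
  by apply: Gamma_ge; rewrite /x; move: d1; lra.
have xE : x `^ x = x * x `^ (x - 1).
  rewrite -[X in _ = X * _](powRr1 (ltW x0)) -powRD; first by congr (_ `^ _); ring.
  by rewrite (gt_eqF x0) implybT.
have xx0 : 0 < x `^ x by rewrite powR_gt0.
have ex0 := expR_gt0 x.
(* [Gamma_ge] turns the sphere area into [2 x (2 pi e / x) ^ x] up to the factor [2]. *)
have key : (pi * expR 1 * mu / (2 * x)) `^ x <= (5 * side) ^+ d.
  have -> : (5 * side) ^+ d = ((5 * side) ^+ 2) `^ x.
    rewrite -(powR_mulrn 2) ?mulr_ge0 ?(ltW s0) // -powRrM -powR_mulrn ?mulr_ge0 ?(ltW s0) //.
    by congr (_ `^ _); rewrite /x; field.
  apply: ge0_ler_powR; rewrite ?nnegrE ?ltW ?divr_gt0 ?mulr_gt0 ?expR_gt0 ?exprn_gt0 //.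
  rewrite exprMn side2 /x.
  have -> : pi * expR 1 * mu / (2 * (d%:R / 2)) = (pi * expR 1) * (mu / d%:R) by field; rewrite gt_eqF.
  have -> : 5 ^+ 2 * (mu / (2 * d%:R)) = (25 / 2) * (mu / d%:R) by field; rewrite gt_eqF.
  rewrite ltr_pM2r ?divr_gt0 //.
  have : pi * expR 1 <= 4 * 3 :> R.
    by apply: ler_pM; rewrite ?expR_ge0 ?pi_le4 ?expR1_le3 // ltW.
  lra.
set Z := (_ / _) `^ x in key; set E := expR x in ex0; set X := x `^ x in xx0 xE.
set P := pi `^ x; set m := mu `^ x; set t := 2 `^ x.
have t0 : 0 < t by rewrite powR_gt0.
have P0 : 0 < P by rewrite powR_gt0.
have m0 : 0 < m by rewrite powR_gt0.
have ZE : Z * (t * X) = P * E * m.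
  rewrite /Z /t /X /P /E /m -!powRM ?mulr_ge0 ?divr_ge0 ?mulr_ge0 ?expR_ge0 ?ltW //.
  have -> : expR x = expR 1 `^ x by rewrite -expRM mul1r.
  rewrite -!powRM ?mulr_ge0 ?expR_ge0 ?ltW //; congr (_ `^ _).
    by field; rewrite gt_eqF.
  by rewrite invr_gt0 mulr_gt0.
have alphaE : alphastar d mu = P * mu * m / (Gamma x * t * (2 * pi) ^+ d * (4 * d%:R) ^+ 5).
  rewrite /alphastar /sphere_area -/x -/P.
  have -> : (2 + d%:R) / 2 = 1 + x :> R by rewrite /x; field.
  rewrite !powRD ?(gt_eqF mu_gt0) ?pnatr_eq0 ?implybT // !powRr1 ?(ltW mu_gt0) // -/m -/t.
  by field; rewrite ?gt_eqF ?exprn_gt0 ?mulr_gt0.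
have step1 : alphastar d mu <= P * mu * m * (2 * x * E / X) / (t * (2 * pi) ^+ d * (4 * d%:R) ^+ 5).
  rewrite alphaE.
  have -> : P * mu * m / (Gamma x * t * (2 * pi) ^+ d * (4 * d%:R) ^+ 5) =
    P * mu * m * (Gamma x)^-1 / (t * (2 * pi) ^+ d * (4 * d%:R) ^+ 5).
    by field; rewrite ?gt_eqF ?exprn_gt0 ?mulr_gt0.
  rewrite ler_pM2r ?invr_gt0 ?mulr_gt0 ?exprn_gt0 ?mulr_gt0 //.
  rewrite ler_pM2l ?mulr_gt0 //.
  rewrite -[X in _ <= X]invrK lef_pV2 ?posrE ?invr_gt0 ?mulr_gt0 ?invr_gt0 //.
  apply: le_trans Gx; rewrite expRN -/E.
  have -> : x `^ (x - 1) = X / x by rewrite xE mulrAC divff ?mul1r // gt_eqF.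
  by rewrite le_eqVlt; apply/orP; left; apply/eqP; field; rewrite ?gt_eqF.
apply: (le_trans step1).
have -> : P * mu * m * (2 * x * E / X) / (t * (2 * pi) ^+ d * (4 * d%:R) ^+ 5) =
  (P * E * m) / (t * X) * (2 * x * mu) / ((2 * pi) ^+ d * (4 * d%:R) ^+ 5).
  by field; rewrite ?gt_eqF ?exprn_gt0 ?mulr_gt0.
rewrite -ZE mulfK ?gt_eqF ?mulr_gt0 //.
have -> : mu * 5 ^+ d * low_density / (1024 * d%:R ^+ 4) =
  (5 * side) ^+ d * (2 * x * mu) / ((2 * pi) ^+ d * (4 * d%:R) ^+ 5).
  rewrite /low_density expr_div_n !exprMn /x.
  by field; rewrite ?gt_eqF ?exprn_gt0 ?mulr_gt0.
rewrite ler_pM2r ?invr_gt0 ?mulr_gt0 ?exprn_gt0 ?mulr_gt0 //.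
by rewrite ler_pM2r // !mulr_gt0.
Qed.

Lemma kappa_gt0 : 0 < kappa d mu.
Proof.
have d0 : 0 < d%:R :> R by rewrite ltr0n.
have b : 0 < 1 + 2 * ln 2 * (d%:R^-1 + 1) + ln (4 * d%:R / mu).
  have l2 : 0 <= ln (2 : R) by rewrite ln_ge0 // ler1n.
  have l4 : 0 <= ln (4 * d%:R / mu).
    rewrite ln_ge0 // ler_pdivlMr // mul1r; move: mu_le d1; lra.
  have : 0 <= 2 * ln 2 * (d%:R^-1 + 1) :> R.
    by rewrite !mulr_ge0 // addr_ge0 // invr_ge0 ltW.
  lra.
by rewrite /kappa mulr_gt0 ?invr_gt0 ?exprn_gt0 // divr_gt0 ?mulr_gt0 ?exprn_gt0 ?expR_gt0.
Qed.

Lemma Mstar_gt0 : 0 < Mstar d mu.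
Proof. by rewrite /Mstar divr_gt0 ?mulr_gt0 ?exprn_gt0 ?mulr_gt0 ?ltr0n. Qed.

Lemma deltastar_gt0 : 0 < deltastar d mu (alphastar d mu).
Proof.
have a0 := alphastar_gt0; have M0 := Mstar_gt0; have k0 := kappa_gt0.
have M1 : 0 < 4 * Mstar d mu + 1 by lra.
rewrite /deltastar !lt_min; apply/and3P; split.
- by rewrite divr_gt0 // exprn_gt0 // mulr_gt0 // ltr0n.
- by rewrite divr_gt0 // !mulr_gt0 // exprn_gt0.
- by rewrite divr_gt0.
Qed.

(** For [D = 2 * d], [seg_const] is at least [3 * mu * low_density / (1024 * d ^ 3)]; as [18 / 25]
    is a little below [3 / 4], [4 * theta] stays just under this. *)
Definition theta : R := 18 / 25 * (mu * low_density / (1024 * d%:R ^+ 3)).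

Lemma theta_gt0 : 0 < theta.
Proof.
have d0 : 0 < d%:R :> R by rewrite ltr0n.
have y0 := low_density_gt0.
have k0 : 0 < 1024 :> R by rewrite ltr0n.
apply: mulr_gt0; first by rewrite divr_gt0 ?ltr0n.
apply: divr_gt0; first exact: mulr_gt0.
by apply: mulr_gt0 => //; apply: exprn_gt0.
Qed.

Section LargeU.
Variable U : R.
Hypothesis U_ge : Ustar d mu (alphastar d mu) <= U.

(** [de] stands for any single entry of the minimum [deltastar], to be chosen according to the
    dimension. *)
Lemma Ustar_ge (de : R) : deltastar d mu (alphastar d mu) <= de ->
  24 * d%:R ^+ 2 <= U * (alphastar d mu * de).
Proof.
move=> h; have a0 := alphastar_gt0; have e0 := deltastar_gt0.
have de0 : 0 < de := lt_le_trans e0 h.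
have dd : 0 < 24 * d%:R ^+ 2 :> R by rewrite mulr_gt0 // exprn_gt0 ?ltr0n.
have q0 := mulr_gt0 a0 e0; have q1 := mulr_gt0 a0 de0.
rewrite -ler_pdivrMr //; apply: (le_trans _ U_ge).
rewrite /Ustar le_max; apply/orP; right.
by rewrite (ler_pM2l dd) lef_pV2 ?posrE // (ler_pM2l a0).
Qed.

(* [d = 1] uses the first entry of [deltastar], [d >= 2] the second one:
   neither suffices for all [d] and [mu]. *)
Lemma U_theta : 201 / 100 * d%:R <= U * theta ^+ 3.
Proof.
have d0 : 0 < d%:R :> R by rewrite ltr0n.
have a0 := alphastar_gt0; have ale := alphastar_le; have t0 := theta_gt0.
have y0 := low_density_gt0; have M0 := Mstar_gt0.
set a := alphastar d mu in a0 ale *.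
have U0 : 0 <= U.
  have := Ustar_ge (lexx _); rewrite -/a => h.
  rewrite -(pmulr_lge0 _ (mulr_gt0 a0 deltastar_gt0)); apply: le_trans h.
  by rewrite mulr_ge0 // exprn_ge0 // ltW.
have aB : a * (18 / 25 * d%:R) <= 5 ^+ d * theta.
  have -> : 5 ^+ d * theta =
      mu * 5 ^+ d * low_density / (1024 * d%:R ^+ 4) * (18 / 25 * d%:R).
    by rewrite /theta; field; rewrite gt_eqF.
  by rewrite ler_pM2r // mulr_gt0.
have := d_gt0; rewrite leq_eqVlt => /orP[/eqP dE|d2].
  have hde : deltastar d mu a <= a ^+ 2 / (12 * d%:R) ^+ 2.
    by rewrite /deltastar ge_min lexx.
  move: (Ustar_ge hde) aB; rewrite -/a -dE !mulr1 expr1 expr1n mulr1 => h aB.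
  have a3 : a ^+ 3 <= (125 / 18 * theta) ^+ 3.
    by rewrite lerXn2r // ?nnegrE; lra.
  have : U * a ^+ 3 <= U * (125 / 18 * theta) ^+ 3 by rewrite ler_wpM2l.
  have -> : U * (125 / 18 * theta) ^+ 3 = (125 / 18) ^+ 3 * (U * theta ^+ 3) by ring.
  move=> h2.
  (* This suffices because [24 * 12 ^ 2] exceeds [10 * (125 / 18) ^ 3]. *)
  have h3 : 24 * 12 ^+ 2 <= U * a ^+ 3.
    move: h; rewrite !mulrA ler_pdivlMr ?exprn_gt0 //; lra.
  by move: (U * theta ^+ 3) (U * a ^+ 3) h2 h3 => z w h2 h3; lra.
have hde : deltastar d mu a <= a / (3 * mu * (4 * Mstar d mu + 1) ^+ d).
  by rewrite /deltastar !ge_min lexx orbT.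
have h := Ustar_ge hde; rewrite -/a in h.
have [Q QE] : exists Q, Q = 768 * d%:R ^+ 2 / mu ^+ 2 by exists (768 * d%:R ^+ 2 / mu ^+ 2).
have MQ : 4 * Mstar d mu = Q by rewrite QE /Mstar; field; rewrite gt_eqF.
have Q0 : 0 < Q by rewrite -MQ mulr_gt0.
have Q10 : 0 < Q + 1 by rewrite addr_gt0.
have q0 : 0 < 3 * mu * (Q + 1) ^+ d.
  by apply: mulr_gt0; [apply: mulr_gt0|apply: exprn_gt0].
have h1 : 24 * d%:R ^+ 2 * (3 * mu * Q ^+ d) <= U * a ^+ 2.
  apply: (@le_trans _ _ (24 * d%:R ^+ 2 * (3 * mu * (Q + 1) ^+ d))).
    apply: ler_wpM2l; first by rewrite mulr_ge0 // exprn_ge0 // ltW.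
    apply: ler_wpM2l; first by rewrite mulr_ge0 // ltW.
    by apply: lerXn2r; rewrite ?nnegrE ?(ltW Q0) ?(ltW Q10) // lerDl.
  rewrite MQ in h; move: q0 h; set q := 3 * mu * _ => q0 h.
  have -> : U * a ^+ 2 = U * (a * (a / q)) * q by field; exact: lt0r_neq0.
  by rewrite (ler_pM2r q0).
have h2 : U * a ^+ 2 * (18 / 25 * d%:R) ^+ 2 <= U * (5 ^+ d * theta) ^+ 2.
  have c0 : 0 < 18 / 25 * d%:R :> R by apply: mulr_gt0; rewrite ?divr_gt0.
  have w0 : 0 < 5 ^+ d * theta by rewrite mulr_gt0 // exprn_gt0.
  rewrite -mulrA -exprMn; apply: ler_wpM2l => //.
  by apply: lerXn2r => //; rewrite nnegrE; [apply/ltW/mulr_gt0|apply: ltW].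
(* [B] is chosen so that [(25 * B) ^ d = Q ^ d * low_density]. As [B >= 1] and [d >= 2], [B ^ d] can
   be bounded below by [B ^ 2], which is explicit. *)
pose B : R := 768 / 25 * d%:R ^+ 2 / mu ^+ 2 * (side / (2 * pi)).
have p0 := pi_gt0 R; have s0 := side_gt0.
have BE : B ^+ d * 25 ^+ d = Q ^+ d * low_density.
  rewrite /low_density -!exprMn; congr (_ ^+ _); rewrite QE /B.
  by move: pi side p0 s0 => p sd p0 s0; field; rewrite !gt_eqF.
have d20 : 0 < d%:R ^+ 2 :> R by exact: exprn_gt0.
have mu20 : 0 < mu ^+ 2 by exact: exprn_gt0.
have B0 : 0 < B.
  have k0 : 0 < 768 / 25 :> R by apply: divr_gt0; rewrite ltr0n.
  have pp : 0 < 2 * pi :> R by apply: mulr_gt0; rewrite ?ltr0n.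
  exact: mulr_gt0 (divr_gt0 (mulr_gt0 k0 d20) mu20) (divr_gt0 s0 pp).
have B2 : 7 * d%:R ^+ 3 <= mu ^+ 3 * B ^+ 2.
  have -> : mu ^+ 3 * B ^+ 2 = (768 / 25) ^+ 2 * d%:R ^+ 3 / (8 * pi ^+ 2).
    have -> : B ^+ 2 = (768 / 25 * d%:R ^+ 2 / mu ^+ 2) ^+ 2 * (mu / (2 * d%:R)) / (2 * pi) ^+ 2.
      by rewrite -side2 /B; move: pi side p0 s0 => p sd p0 s0; field; rewrite !gt_eqF.
    by move: pi p0 => p p0; field; rewrite !gt_eqF.
  have p20 : 0 < pi ^+ 2 :> R by exact: exprn_gt0.
  rewrite ler_pdivlMr ?mulr_gt0 // mulrAC ler_pM2r ?exprn_gt0 //.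
  have : pi ^+ 2 <= 4 ^+ 2 :> R by apply: lerXn2r; rewrite ?nnegrE ?pi_le4 ?(ltW p0).
  lra.
have mu3 : mu ^+ 3 <= 1 by rewrite exprn_ile1 ?ltW //; move: mu_le; lra.
have d3 : 1 <= d%:R ^+ 3 :> R by rewrite exprn_ege1.
have B1 : 1 <= B.
  rewrite -(@expr_ge1 _ 2) ?(ltW B0) //.
  have : mu ^+ 3 * B ^+ 2 <= 1 * B ^+ 2 by rewrite ler_wpM2r // sqr_ge0.
  lra.
have Bd : B ^+ 2 <= B ^+ d by rewrite ler_weXn2l.
have dR2 : 2 <= d%:R :> R by rewrite ler_nat.
have muB : 112 <= mu ^+ 2 * B ^+ 2.
  rewrite -(ler_pM2l mu_gt0) mulrA -exprS; apply: le_trans B2.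
  have : 2 ^+ 3 <= d%:R ^+ 3 :> R by rewrite lerXn2r ?nnegrE // ltW.
  by move: mu_le; lra.
have P25 : 0 < 25 ^+ d :> R by rewrite exprn_gt0.
rewrite -(ler_pM2r P25).
have step : 24 * d%:R ^+ 2 * (3 * mu * Q ^+ d)
    * (18 / 25 * d%:R) ^+ 2 * theta <= U * theta ^+ 3 * 25 ^+ d.
  have -> : U * theta ^+ 3 * 25 ^+ d = U * (5 ^+ d * theta) ^+ 2 * theta.
    have -> : 25 = 5 ^+ 2 :> R by ring.
    by rewrite -exprM mulnC exprM; ring.
  rewrite ler_pM2r //; apply: le_trans h2.
  by rewrite ler_wpM2r // exprn_ge0 // ltW // mulr_gt0.
apply: le_trans step.
have -> : 24 * d%:R ^+ 2 * (3 * mu * Q ^+ d)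
    * (18 / 25 * d%:R) ^+ 2 * theta =
  72 * (18 / 25) ^+ 3 / 1024 * d%:R * (mu ^+ 2 * B ^+ d) * 25 ^+ d.
  transitivity (72 * (18 / 25) ^+ 3 / 1024 * d%:R * mu ^+ 2 * (B ^+ d * 25 ^+ d)).
    rewrite BE /theta; field; exact: lt0r_neq0.
  ring.
rewrite (ler_pM2r P25) [X in _ <= X]mulrAC (ler_pM2r d0).
have muB' : mu ^+ 2 * B ^+ 2 <= mu ^+ 2 * B ^+ d by rewrite (ler_pM2l mu20).
have := le_trans muB muB'; move: (_ * _ ^+ d) => z hz; lra.
Qed.

(** After multiplication by [theta], the surplus [d / 100] in [U_theta] absorbs [mu * theta]. *)
Lemma U_large : mu + (2 * d)%:R / theta < U * theta ^+ 2.
Proof.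
have t0 := theta_gt0; rewrite -(ltr_pM2r t0) mulrDl divfK ?gt_eqF // -mulrA -exprSr.
have d0 : 0 < d%:R :> R by rewrite ltr0n.
apply: lt_le_trans U_theta; rewrite natrM.
have s0 := side_gt0; have p0 := pi_gt0 R.
have y1 : low_density <= 1.
  rewrite exprn_ile1 ?divr_ge0 ?mulr_ge0 ?ltW //.
  rewrite ltr_pdivrMr ?mulr_gt0 // mul1r; have := side_le; have := pi_ge2 R; lra.
have y0 := low_density_gt0.
have e : theta * d%:R ^+ 3 * 1024 = 18 / 25 * (mu * low_density).
  by rewrite /theta; field; exact: lt0r_neq0.
have my : mu * low_density <= 1 / 2 * 1.
  by apply: ler_pM => //; exact: ltW.
have td : theta * 1 <= theta * d%:R ^+ 3 by rewrite ler_pM2l // exprn_ege1.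
have mt : mu * theta <= 1 / 2 * theta by rewrite ler_wpM2r // ltW.
move: (theta * _ ^+ 3) (mu * low_density) e my td => z w e my td.
move: d1; lra.
Qed.

End LargeU.

(** The indices from 0 to [m] number [m + 1], so truncation never lowers the proportion of low modes
    below [low_density], at any finite [L]. *)
Lemma theta_small (L m : nat) : (0 < L)%N -> side * L%:R / (2 * pi) <= m.+1%:R ->
  4 * theta < mu / 2 * (3 / 4 * (m.+1 ^ d)%:R / (L ^ d)%:R) / (16 * (2 * d)%:R ^+ 3).
Proof.
move=> L0 hm; have d0 : 0 < d%:R :> R by rewrite ltr0n.
have L0' : 0 < L%:R :> R by rewrite ltr0n.
have p0 := pi_gt0 R; have s0 := side_gt0; have y0 := low_density_gt0.
have h : low_density <= (m.+1 ^ d)%:R / (L ^ d)%:R.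
  have h0 : side / (2 * pi) <= m.+1%:R / L%:R by rewrite ler_pdivlMr // mulrAC.
  rewrite !natrX -expr_div_n /low_density; apply: lerXn2r => //.
    by rewrite nnegrE divr_ge0 ?(ltW s0) // mulr_ge0 // ltW.
  by rewrite nnegrE divr_ge0.
apply: (@lt_le_trans _ _ (mu / 2 * (3 / 4 * low_density) / (16 * (2 * d)%:R ^+ 3))).
  rewrite natrM /theta.
  have -> : mu / 2 * (3 / 4 * low_density) / (16 * (2 * d%:R) ^+ 3) =
    3 * (mu * low_density / (1024 * d%:R ^+ 3)) by field; rewrite gt_eqF.
  have : 0 < mu * low_density / (1024 * d%:R ^+ 3).
    have k0 : 0 < 1024 :> R by rewrite ltr0n.
    exact: divr_gt0 (mulr_gt0 mu_gt0 y0) (mulr_gt0 k0 (exprn_gt0 3 d0)).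
  lra.
apply: ler_wpM2r; first by rewrite invr_ge0 mulr_ge0 // exprn_ge0.
apply: ler_wpM2l; first by rewrite divr_ge0 // ltW.
rewrite -[X in _ <= X]mulrA; by apply: ler_wpM2l.
Qed.

Lemma Lstar_gt2 (L : nat) : Lstar d mu <= L%:R -> (2 < L)%N.
Proof.
move=> h; rewrite -(ltr_nat R); apply: lt_le_trans h.
rewrite /Lstar /Mstar mulrA ltr_pdivlMr ?exprn_gt0 //.
have : mu ^+ 2 <= 1 by rewrite exprn_ile1 ?ltW //; move: mu_le; lra.
have : (4 * 1) ^+ 2 <= (4 * d%:R) ^+ 2 :> R.
  by rewrite lerXn2r ?nnegrE ?mulr_ge0 // ler_wpM2l.
lra.
Qed.

End Constants.

(** * The theorem *)
Section Main.
Context {R : realType} {d L : nat} (mu U : R).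
Local Notation C := R[i].
Hypotheses (d_gt0 : (0 < d)%N) (mu_gt0 : 0 < mu) (mu_le : mu <= 1 / 2).
Hypotheses (L_ge : Lstar d mu <= L%:R) (U_ge : Ustar d mu (alphastar d mu) <= U).
Local Notation n := (nsites d L).
Local Notation t := (@dispersion R d L mu).
Local Notation ground := (\sum_(i | t i < 0) t i).
Local Notation P := (fermi (@fourier R d L) t).

Let L_gt2 : (2 < L)%N. Proof. exact: Lstar_gt2 L_ge. Qed.
Let diagK := fourier_diagonalizes L_gt2 d_gt0 mu.

(** The largest [m] with [ang m <= side]. *)
Definition cutoff : nat := Num.truncn (side d mu * L%:R / (2 * pi)).

Lemma cutoff_ub : side d mu * L%:R / (2 * pi) <= cutoff.+1%:R.
Proof. by apply/ltW/truncnS_gt. Qed.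

Lemma cutoff_lb : cutoff%:R <= side d mu * L%:R / (2 * pi).
Proof.
suff : 0 <= side d mu * L%:R / (2 * pi) by move=> /truncn_itv /andP[].
have s0 := side_gt0 d_gt0 mu_gt0; have p0 := pi_gt0 R.
by rewrite divr_ge0 // mulr_ge0 // ltW.
Qed.

Lemma cutoff_lt : (cutoff < L)%N.
Proof.
have s0 := side_gt0 d_gt0 mu_gt0; have p0 := pi_ge2 R.
have s1 := side_le d_gt0 mu_gt0 mu_le.
have L0 : 0 < L%:R :> R by rewrite ltr0n; move: L_gt2; lia.
rewrite -(ltr_nat R); apply: (le_lt_trans cutoff_lb).
rewrite ltr_pdivrMr; last by lra.
by rewrite mulrC ltr_pM2l //; lra.
Qed.

Lemma ang_cutoff : ang (L := L) cutoff <= side d mu.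
Proof.
have p0 := pi_gt0 R; have L0 : 0 < L%:R :> R by rewrite ltr0n; move: L_gt2; lia.
have pp : 0 < 2 * pi / L%:R :> R by rewrite divr_gt0 // mulr_gt0.
rewrite /ang -ler_pdivlMr // invf_div mulrA; exact: cutoff_lb.
Qed.

Lemma theta_lt_seg : 4 * theta d mu < seg_const (2 * d) mu (low (L := L) cutoff) (n := n).
Proof.
rewrite /seg_const low_count ?cutoff_lt // nsitesE.
apply: theta_small => //; last exact: cutoff_ub.
by move: L_gt2; lia.
Qed.

(** Reduces comparisons of energies in the partial order of [C] to comparisons of reals. *)
Lemma Ehfz_real gu gd : admissible gu -> admissible gd ->
  Ehfz d L mu U gu gd = (hfz (2 * d) mu (@nbr d L) U gu gd)%:C.
Proof.
move=> [hu _] [hd _]; rewrite /Ehfz /hfz rmorphD rmorphM rmorph_sum /=; congr (_ + _ * _).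
  by rewrite Kmu_ham (tr_diagonalizes diagK (psd_add hu hd)).
apply: eq_bigr => i _; rewrite rmorphM /=.
by rewrite {1}(psd_diag hu) {1}(psd_diag hd).
Qed.

Lemma psd0 : psd (0 : 'M[C]_n).
Proof.
split; first by apply/matrixP => i j; rewrite ctrE !mxE rmorph0.
by move=> v; rewrite mulmx0 mul0mx mxE.
Qed.

Lemma admissible0 : admissible (0 : 'M[C]_n).
Proof. by split; [exact: psd0|rewrite subr0; exact: psd1]. Qed.

Lemma Ehfz_fermi : Ehfz d L mu U P 0 = ground%:C.
Proof.
rewrite /Ehfz addr0 Kmu_ham (tr_fermi diagK) [X in _ + _ * X]big1 ?mulr0 ?addr0 // => i _.
by rewrite [X in _ * X]mxE mulr0.
Qed.

Lemma trneg_Kmu : trneg (Kmu d L mu) = ground%:C.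
Proof. by rewrite Kmu_ham (trneg_diagonalizes diagK). Qed.

Section Densities.
Variables (gu gd : 'M[C]_n).
Hypotheses (gu_adm : admissible gu) (gd_adm : admissible gd).

Lemma hfz_lattice_ge : ground <= hfz (2 * d) mu (@nbr d L) U gu gd.
Proof.
apply: (hfz_ge (nbr_sym L_gt2) (nbr_irr L_gt2) (nbr_deg L_gt2)
  _ mu_gt0 mu_le diagK _ _ gu_adm gd_adm (theta_gt0 d_gt0 mu_gt0) theta_lt_seg
  (U_large d_gt0 mu_gt0 mu_le U_ge)).
- by rewrite muln_gt0.
- by move=> k; apply: low_dispersion (side2 d_gt0 mu_gt0) ang_cutoff _ => //; exact/ltW/side_gt0.
- by move=> l k; apply: low_local (side2 d_gt0 mu_gt0) ang_cutoff l k => //; exact/ltW/side_gt0.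
Qed.

Lemma hfz_lattice_eq : hfz (2 * d) mu (@nbr d L) U gu gd = ground ->
  (forall i, t i != 0) -> (gu = P /\ gd = 0) \/ (gu = 0 /\ gd = P).
Proof.
apply: (hfz_eq (nbr_sym L_gt2) (nbr_irr L_gt2) (nbr_deg L_gt2) (nbr_conn L_gt2)
  _ mu_gt0 mu_le diagK _ _ gu_adm gd_adm (theta_gt0 d_gt0 mu_gt0) theta_lt_seg
  (U_large d_gt0 mu_gt0 mu_le U_ge)).
- by rewrite muln_gt0.
- by move=> k; apply: low_dispersion (side2 d_gt0 mu_gt0) ang_cutoff _ => //; exact/ltW/side_gt0.
- by move=> l k; apply: low_local (side2 d_gt0 mu_gt0) ang_cutoff l k => //; exact/ltW/side_gt0.
Qed.

End Densities.

Lemma dispersion_neq0 : ~~ eigenvalue (- @lap R d L) mu%:C -> forall i, t i != 0.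
Proof.
move=> h i; apply: contra h => /eqP ti; apply/eigenvalueP.
have /eigenvalueP[v vK v0] := eigenvalue_diagonalizes diagK i; exists v => //.
move: vK; rewrite -Kmu_ham // ti scale0r /Kmu mulmxBr => /eqP.
by rewrite subr_eq0 mul_mx_scalar => /eqP.
Qed.

Lemma fermi_spec_proj : spec_proj_below (- @lap R d L) mu P.
Proof.
move=> a v h; rewrite (fermi_eigen diagK (a := a - mu%:C)) ?subr_lt0 //.
by rewrite -Kmu_ham // /Kmu mulmxBl h mul_scalar_mx scalerBl.
Qed.

End Main.

Theorem theorem1p2 (R : realType) (d : nat) (mu : R) :
  (1 <= d)%N -> 0 < mu -> mu <= 1 / 2 ->
  forall (L : nat) (U : R),
    ~~ odd L -> Lstar d mu <= L%:R -> Ustar d mu (alphastar d mu) <= U ->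
    is_hfz_min_value d L mu U (trneg (Kmu d L mu))
    /\ (~~ eigenvalue (- @lap R d L) (mu%:C)%C ->
        forall gu gd, is_hfz_minimizer d L mu U gu gd ->
        exists P, spec_proj_below (- @lap R d L) mu P /\
          ((gu = P /\ gd = 0) \/ (gu = 0 /\ gd = P))).
Proof.
move=> d0 mu0 mu1 L U _ L_ge U_ge.
have L2 := Lstar_gt2 d0 mu0 mu1 L_ge.
have adm := fermi_admissible (fourier_diagonalizes L2 d0 mu).
rewrite (trneg_Kmu d0 mu0 mu1 L_ge); split.
  split.
    exists (fermi fourier (dispersion mu)), 0; split; [exact: adm|exact: admissible0|].
    exact: Ehfz_fermi.
  move=> gu gd hu hd; rewrite (Ehfz_real U d0 mu0 mu1 L_ge) // lecR.
  exact: hfz_lattice_ge.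
move=> mu_ev gu gd [hu hd hmin].
exists (fermi fourier (dispersion mu)); split; first exact: fermi_spec_proj.
apply: (hfz_lattice_eq d0 mu0 mu1 L_ge U_ge hu hd); last exact: dispersion_neq0.
(* Minimality against the trial pair of the Fermi projection and 0 supplies the other inequality. *)
apply/eqP; rewrite eq_le hfz_lattice_ge // andbT.
have := hmin _ _ adm admissible0.
by rewrite (Ehfz_fermi U d0 mu0 mu1 L_ge) (Ehfz_real U d0 mu0 mu1 L_ge) // lecR.
Qed.
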